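(* Let $(\phi_t)$ be a non-elliptic semigroup in $\mathbb{D}$, let $h$ be its Koenigs function, $\Omega=h(\mathbb{D})$ and $\tau\in \partial \mathbb{D}$ its Denjoy-Wolff point. If there exist $\beta\in (0,\pi/2)$ and $q\in \Omega$ such that $q+iV(\beta,0)\subset \Omega$, then $\phi_t(z)$ converges non-tangentially to $\tau$ as $t\to+\infty$ for all $z\in \mathbb{D}$.
   Context: $\mathbb{D}=\{z\in\mathbb{C}:|z|<1\}$. $V(\beta,0)=\{\rho e^{i\theta}:\rho>0,\ |\theta|<\beta\}$. A semigroup in $\mathbb{D}$ is a family $(\phi_t)_{t\ge0}$ of holomorphic self-maps of $\mathbb{D}$ with $\phi_0=\mathrm{id}$, $\phi_{s+t}=\phi_s\circ\phi_t$, and $t\mapsto\phi_t$ continuous for uniform convergence on compacta. If it is not a group of hyperbolic rotations, there is a unique $\tau\in\overline{\mathbb{D}}$, the Denjoy-Wolff point, with $\lim_{t\to+\infty}\phi_t(z)=\tau$ for all $z\in\mathbb{D}$. The semigroup is non-elliptic if $\tau\in\partial\mathbb{D}$. The Koenigs function of a non-elliptic semigroup is a univalent (injective holomorphic) function $h:\mathbb{D}\to\mathbb{C}$ with $h(\phi_t(z))=h(z)+it$ for all $t\ge0$, $z\in\mathbb{D}$ (so $h(\mathbb{D})+it\subset h(\mathbb{D})$ for $t\ge0$), such that $\bigcup_{t\ge0}(h(\mathbb{D})-it)$ is either $\mathbb{C}$, or a half-plane bounded by a vertical line, or a vertical strip; it is essentially unique. A trajectory $\phi_t(z)$ converges non-tangentially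 to $\tau$ if it converges to $\tau$ and there is $A>1$ such that $|\tau-\phi_t(z)|<A(1-|\phi_t(z)|)$ for all $t$ large enough. *)

(* Defs.v *)
From Stdlib Require Export Reals List.
From Coquelicot Require Export Coquelicot.

Open Scope R_scope.

Definition disc (z : C) : Prop := Cmod z < 1.

Definition holomorphic_on (D : C -> Prop) (f : C -> C) : Prop :=
  forall z : C, D z -> ex_derive (K := C_AbsRing) (V := C_NormedModule) f z.

(** Coquelicot has no compactness predicate for subsets of [C]. *)
Definition compact_set (K : C -> Prop) : Prop :=
  forall (I : Type) (U : I -> C -> Prop),
    (forall i, open (U i)) ->
    (forall z, K z -> exists i, U i z) ->
    exists l : list I, forall z, K z -> exists i, In i l /\ U i z.

(** A semigroup is a function [phi : R -> C -> C] of which only the values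
    [phi t z] with [0 <= t] and [z] in the disc are meaningful; all the
    conditions below are restricted to these. *)
Definition semigroup (phi : R -> C -> C) : Prop :=
  (forall t, 0 <= t ->
     holomorphic_on disc (phi t) /\ (forall z, disc z -> disc (phi t z))) /\
  (forall z, disc z -> phi 0 z = z) /\
  (forall s t z, 0 <= s -> 0 <= t -> disc z ->
     phi (s + t) z = phi s (phi t z)) /\
  (forall t0, 0 <= t0 ->
     forall K, compact_set K -> (forall z, K z -> disc z) ->
     forall eps, 0 < eps ->
       within (fun t => 0 <= t) (locally t0)
         (fun t => forall z, K z -> Cmod (phi t z - phi t0 z) < eps)).

(** A group of hyperbolic rotations has no Denjoy-Wolff point in this sense:
    if it is non-trivial, its orbits away from the fixed point do not converge;
    if it is trivial, they have distinct limits. *)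
Definition denjoy_wolff_point (phi : R -> C -> C) (tau : C) : Prop :=
  Cmod tau <= 1 /\
  forall z, disc z ->
    filterlim (fun t => phi t z) (Rbar_locally p_infty) (locally tau).

Definition non_elliptic (phi : R -> C -> C) : Prop :=
  exists tau : C, denjoy_wolff_point phi tau /\ Cmod tau = 1.

Definition univalent_on (D : C -> Prop) (f : C -> C) : Prop :=
  holomorphic_on D f /\
  forall z w, D z -> D w -> f z = f w -> z = w.

Definition image (f : C -> C) (D : C -> Prop) (w : C) : Prop :=
  exists z, D z /\ f z = w.

(** The union of the translates [Omega - i t], [0 <= t]. *)
Definition downward_union (Omega : C -> Prop) (w : C) : Prop :=
  exists t : R, 0 <= t /\ Omega (w + Ci * RtoC t)%C.

Definition vertical_half_plane (S : C -> Prop) : Prop :=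
  exists a : R, (forall w, S w <-> a < Re w) \/ (forall w, S w <-> Re w < a).

Definition vertical_strip (S : C -> Prop) : Prop :=
  exists a b : R, a < b /\ forall w, S w <-> a < Re w < b.

Definition koenigs_function (phi : R -> C -> C) (h : C -> C) : Prop :=
  univalent_on disc h /\
  (forall t z, 0 <= t -> disc z -> h (phi t z) = (h z + Ci * RtoC t)%C) /\
  let S := downward_union (image h disc) in
  (forall w, S w) \/ vertical_half_plane S \/ vertical_strip S.

(** [V(beta, 0)]. *)
Definition sector (beta : R) (v : C) : Prop :=
  exists rho theta : R,
    0 < rho /\ Rabs theta < beta /\
    v = (RtoC rho * (cos theta, sin theta))%C.

Definition non_tangential (gamma : R -> C) (tau : C) : Prop :=
  filterlim gamma (Rbar_locally p_infty) (locally tau) /\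
  exists A : R, 1 < A /\
    Rbar_locally p_infty
      (fun t => Cmod (tau - gamma t) < A * (1 - Cmod (gamma t))).

(* Main.v *)
Require Import Defs.
From Stdlib Require Import Lra Lia Psatz ClassicalEpsilon Classical.

(** Let W = (tau + z) / (tau - z), which sends the disc to the right half-plane and tau to
    infinity; non-tangential convergence to tau means |W| <= A Re W along the orbit. Write
    W t for the value at phi t z.

    Three facts control W t. First, by Julia's lemma ([julia], [orbit_julia]), Re (W t) is
    nondecreasing. Second, the sector provides in the image of h discs about h z + i t of
    radius proportional to t; by the Schwarz lemma applied to the inverse of h on these
    discs ([subordination]), W moves by at most 2 Re (W s) between times s and lam s, for
    a fixed lam > 1. Third, the image of h omits a point p, hence the ray below p, so that
    the square root of (h - p) / i maps the disc to a half-plane; by Schwarz-Pick the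
    hyperbolic distance between the points of the orbit at times t and K t is at least of
    order log K ([koenigs_distance_growth]).

    In [stolz_growth] these are combined. Over n steps, with K = lam^n, the distance grows
    at least linearly in n. If Re W did not double meanwhile, the Euclidean displacement of
    W would be O(n Re W) between comparable real parts, hence the hyperbolic distance only
    O(log n), which is impossible for a large fixed n. So Re W at least doubles from t to
    K t, and |W t| is bounded by a geometric sum, that is by a multiple of Re (W t).

    The function theory behind this is built from complex differentiability alone. Goursat's
    bisection argument in logarithmic polar coordinates yields the mean value property
    ([submean]); the openness of univalent functions, a maximum principle on the preimage
    of a disc and the Schwarz lemma follow from it. The inverse of a univalent function
    enters only through its continuity. *)

(** * Bisection of rectangles *)

Lemma nested_intervals (u v : nat -> R) :
  (forall n, u n <= u (S n)) -> (forall n, v (S n) <= v n) ->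
  (forall n, u n <= v n) ->
  exists x, forall n, u n <= x <= v n.
Proof.
  intros Hu Hv Huv.
  assert (Hum : forall n k, u n <= u (n + k)%nat).
  { intros n k; induction k as [|k IH].
    - rewrite Nat.add_0_r; lra.
    - rewrite Nat.add_succ_r; specialize (Hu (n + k)%nat); lra. }
  assert (Hvm : forall n k, v (n + k)%nat <= v n).
  { intros n k; induction k as [|k IH].
    - rewrite Nat.add_0_r; lra.
    - rewrite Nat.add_succ_r; specialize (Hv (n + k)%nat); lra. }
  assert (Hx : forall n m, u n <= v m).
  { intros n m; pose proof (Hum n m); pose proof (Hvm m n).
    rewrite (Nat.add_comm m n) in H0; specialize (Huv (n + m)%nat); lra. }
  destruct (completeness (fun r => exists n, r = u n)) as [x [Hub Hlub]].
  - exists (v 0%nat); intros r [n ->]; apply Hx.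
  - exists (u 0%nat), 0%nat; reflexivity.
  - exists x; intros n; split.
    + apply Hub; exists n; reflexivity.
    + apply Hlub; intros r [m ->]; apply Hx.
Qed.

Lemma half_pow_small (l delta : R) :
  0 < delta -> exists n : nat, l / 2 ^ n < delta.
Proof.
  intros Hd.
  destruct (Pow_x_infinity 2) with (b := Rabs l / delta + 1) as [n Hn].
  { rewrite Rabs_pos_eq; lra. }
  exists n; specialize (Hn n (le_n n)).
  assert (0 < 2 ^ n) by (apply pow_lt; lra).
  rewrite Rabs_pos_eq in Hn by lra.
  apply Rlt_div_l; [lra|].
  assert (Rabs l / delta < 2 ^ n) by lra.
  apply Rlt_div_l in H0; [|lra].
  pose proof (Rle_abs l); lra.
Qed.

(** Any property of rectangles that is inherited by at least one quarter concentrates at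
    a point. It serves twice as the compactness argument: for the vanishing of closed
    line integrals, and for the existence of maxima. *)
Lemma bisection (P : R -> R -> R -> R -> Prop) (a b c d : R) :
  a <= b -> c <= d -> P a b c d ->
  (forall a b c d, a <= b -> c <= d -> P a b c d ->
     P a ((a + b) / 2) c ((c + d) / 2) \/ P ((a + b) / 2) b c ((c + d) / 2) \/
     P a ((a + b) / 2) ((c + d) / 2) d \/ P ((a + b) / 2) b ((c + d) / 2) d) ->
  exists x y, a <= x <= b /\ c <= y <= d /\
    forall delta, 0 < delta -> exists a' b' c' d',
      (a <= a' /\ a' <= x <= b' /\ b' <= b) /\
      (c <= c' /\ c' <= y <= d' /\ d' <= d) /\
      b' - a' < delta /\ d' - c' < delta /\ P a' b' c' d'.
Proof.
  intros Hab Hcd HP Hstep.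
  set (good := fun r : (R * R) * (R * R) =>
    fst (fst r) <= snd (fst r) /\ fst (snd r) <= snd (snd r) /\
    P (fst (fst r)) (snd (fst r)) (fst (snd r)) (snd (snd r))).
  set (A := fun r : sig good => fst (fst (proj1_sig r))).
  set (B := fun r : sig good => snd (fst (proj1_sig r))).
  set (Cc := fun r : sig good => fst (snd (proj1_sig r))).
  set (Dd := fun r : sig good => snd (snd (proj1_sig r))).
  assert (Hnext : forall r : sig good, exists r' : sig good,
    (A r <= A r' /\ B r' <= B r /\ B r' - A r' = (B r - A r) / 2) /\
    (Cc r <= Cc r' /\ Dd r' <= Dd r /\ Dd r' - Cc r' = (Dd r - Cc r) / 2)).
  { intros [[[a1 b1] [c1 d1]] [H1 [H2 H3]]]; simpl in H1, H2, H3.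
    destruct (Hstep _ _ _ _ H1 H2 H3) as [H|[H|[H|H]]].
    - assert (Hg : good ((a1, (a1 + b1) / 2), (c1, (c1 + d1) / 2)))
        by (repeat split; simpl; try lra; assumption).
      exists (exist _ _ Hg); unfold A, B, Cc, Dd; simpl; lra.
    - assert (Hg : good (((a1 + b1) / 2, b1), (c1, (c1 + d1) / 2)))
        by (repeat split; simpl; try lra; assumption).
      exists (exist _ _ Hg); unfold A, B, Cc, Dd; simpl; lra.
    - assert (Hg : good ((a1, (a1 + b1) / 2), ((c1 + d1) / 2, d1)))
        by (repeat split; simpl; try lra; assumption).
      exists (exist _ _ Hg); unfold A, B, Cc, Dd; simpl; lra.
    - assert (Hg : good (((a1 + b1) / 2, b1), ((c1 + d1) / 2, d1)))
        by (repeat split; simpl; try lra; assumption).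
      exists (exist _ _ Hg); unfold A, B, Cc, Dd; simpl; lra. }
  set (next := fun r => proj1_sig (constructive_indefinite_description _ (Hnext r))).
  assert (Hn : forall r,
    (A r <= A (next r) /\ B (next r) <= B r /\
     B (next r) - A (next r) = (B r - A r) / 2) /\
    (Cc r <= Cc (next r) /\ Dd (next r) <= Dd r /\
     Dd (next r) - Cc (next r) = (Dd r - Cc r) / 2)).
  { intros r; unfold next; apply proj2_sig. }
  assert (Hg0 : good ((a, b), (c, d))) by (repeat split; assumption).
  set (s := fun n => Nat.iter n next (exist _ _ Hg0)).
  assert (Hs : forall n, s (S n) = next (s n)) by reflexivity.
  assert (Hgood : forall r : sig good, A r <= B r /\ Cc r <= Dd r /\
    P (A r) (B r) (Cc r) (Dd r)) by (intros [r Hr]; exact Hr).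
  assert (Hwid : forall n, B (s n) - A (s n) = (b - a) / 2 ^ n /\
                           Dd (s n) - Cc (s n) = (d - c) / 2 ^ n).
  { induction n as [|n [IH1 IH2]].
    - unfold A, B, Cc, Dd; simpl; lra.
    - rewrite Hs; destruct (Hn (s n)) as [[_ [_ E1]] [_ [_ E2]]].
      rewrite E1, E2, IH1, IH2; simpl.
      assert (2 ^ n <> 0) by (apply pow_nonzero; lra).
      split; field; assumption. }
  assert (Hin : forall n, a <= A (s n) /\ B (s n) <= b /\ c <= Cc (s n) /\ Dd (s n) <= d).
  { induction n as [|n IH].
    - unfold A, B, Cc, Dd; simpl; lra.
    - rewrite Hs; specialize (Hn (s n)); lra. }
  destruct (nested_intervals (fun n => A (s n)) (fun n => B (s n))) as [x Hx].
  { intros n; rewrite Hs; apply Hn. }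
  { intros n; rewrite Hs; apply Hn. }
  { intros n; apply Hgood. }
  destruct (nested_intervals (fun n => Cc (s n)) (fun n => Dd (s n))) as [y Hy].
  { intros n; rewrite Hs; apply Hn. }
  { intros n; rewrite Hs; apply Hn. }
  { intros n; apply Hgood. }
  exists x, y.
  split; [apply (Hx 0%nat)|]; split; [apply (Hy 0%nat)|].
  intros delta Hd.
  destruct (half_pow_small ((b - a) + (d - c)) delta Hd) as [n Hsm].
  exists (A (s n)), (B (s n)), (Cc (s n)), (Dd (s n)).
  pose proof (Hx n); pose proof (Hy n); pose proof (Hin n).
  destruct (Hwid n) as [E1 E2].
  assert (0 < 2 ^ n) by (apply pow_lt; lra).
  assert (0 <= (b - a) / 2 ^ n) by (apply Rdiv_le_0_compat; lra).
  assert (0 <= (d - c) / 2 ^ n) by (apply Rdiv_le_0_compat; lra).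
  replace ((b - a + (d - c)) / 2 ^ n) with ((b - a) / 2 ^ n + (d - c) / 2 ^ n) in Hsm
    by (field; lra).
  repeat split; try lra; apply Hgood.
Qed.

(** * Goursat's theorem for differentiable forms *)

(** The integral of the form p dx + q dy along the boundary of the rectangle, with opposite
    sides already paired: in this shape the local estimate below is a pointwise bound on
    the integrands. *)
Definition circulation (p q : R -> R -> R) (a b c d : R) : R :=
  RInt (fun x => p x c - p x d) a b + RInt (fun y => q b y - q a y) c d.

Lemma differentiable_continuous_x (p : R -> R -> R) (x y l m : R) :
  differentiable_pt_lim p x y l m -> continuous (fun t => p t y) x.
Proof.
  intros H.
  apply continuity_pt_filterlim, derivable_continuous_pt.
  exists (l * 1 + m * 0).
  apply (derivable_pt_lim_comp_2d p (fun t => t) (fun _ => y) x l m 1 0 H).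
  - apply derivable_pt_lim_id.
  - apply derivable_pt_lim_const.
Qed.

Lemma differentiable_continuous_y (p : R -> R -> R) (x y l m : R) :
  differentiable_pt_lim p x y l m -> continuous (fun t => p x t) y.
Proof.
  intros H.
  apply continuity_pt_filterlim, derivable_continuous_pt.
  exists (l * 0 + m * 1).
  apply (derivable_pt_lim_comp_2d p (fun _ => x) (fun t => t) y l m 0 1 H).
  - apply derivable_pt_lim_const.
  - apply derivable_pt_lim_id.
Qed.

Lemma circulation_split (p q : R -> R -> R) (a b c d m n : R) :
  a <= m <= b -> c <= n <= d ->
  (forall x y, a <= x <= b -> c <= y <= d -> continuous (fun t => p t y) x) ->
  (forall x y, a <= x <= b -> c <= y <= d -> continuous (fun t => q x t) y) ->
  circulation p q a b c d =
  circulation p q a m c n + circulation p q m b c n +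
  circulation p q a m n d + circulation p q m b n d.
Proof.
  intros Hm Hn Hp Hq.
  assert (Ip : forall s t y1 y2, a <= s <= b -> a <= t <= b -> s <= t -> c <= y1 <= d -> c <= y2 <= d ->
             ex_RInt (fun x => p x y1 - p x y2) s t).
  { intros s t y1 y2 Hs Ht Hst H1 H2; apply (ex_RInt_continuous (V := R_CompleteNormedModule));
    intros z Hz.
    rewrite Rmin_left, Rmax_right in Hz by lra.
    apply (continuous_minus (V := R_NormedModule)); apply Hp; lra. }
  assert (Iq : forall s t y1 y2, c <= s <= d -> c <= t <= d -> s <= t -> a <= y1 <= b -> a <= y2 <= b ->
             ex_RInt (fun x => q y1 x - q y2 x) s t).
  { intros s t y1 y2 Hs Ht Hst H1 H2; apply (ex_RInt_continuous (V := R_CompleteNormedModule));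
    intros z Hz.
    rewrite Rmin_left, Rmax_right in Hz by lra.
    apply (continuous_minus (V := R_NormedModule)); apply Hq; lra. }
  assert (Ep : forall s t, a <= s <= b -> a <= t <= b -> s <= t ->
     RInt (fun x => p x c - p x d) s t =
     RInt (fun x => p x c - p x n) s t + RInt (fun x => p x n - p x d) s t).
  { intros s t Hs Ht Hst.
    rewrite <- (RInt_plus (V := R_CompleteNormedModule)) by (apply Ip; lra).
    apply RInt_ext; intros x _; unfold plus; simpl; ring. }
  assert (Eq : forall s t, c <= s <= d -> c <= t <= d -> s <= t ->
     RInt (fun y => q b y - q a y) s t =
     RInt (fun y => q b y - q m y) s t + RInt (fun y => q m y - q a y) s t).
  { intros s t Hs Ht Hst.
    rewrite <- (RInt_plus (V := R_CompleteNormedModule)) by (apply Iq; lra).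
    apply RInt_ext; intros x _; unfold plus; simpl; ring. }
  unfold circulation.
  rewrite <- (RInt_Chasles (V := R_CompleteNormedModule)
                (fun x => p x c - p x d) a m b) by (apply Ip; lra).
  rewrite <- (RInt_Chasles (V := R_CompleteNormedModule)
                (fun y => q b y - q a y) c n d) by (apply Iq; lra).
  rewrite (Ep a m), (Ep m b), (Eq c n), (Eq n d) by lra.
  unfold plus; simpl; ring.
Qed.

(** The affine parts of p and q contribute nothing, because p_y = q_x = m; what is left
    is the error of first-order approximation times the perimeter. *)
Lemma circulation_local (p q : R -> R -> R) (x y l m k : R) (eps : R) :
  0 < eps ->
  differentiable_pt_lim p x y l m -> differentiable_pt_lim q x y m k ->
  exists delta, 0 < delta /\ forall a b c d,
    a <= x <= b -> c <= y <= d -> b - a < delta -> d - c < delta ->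
    (forall x y, a <= x <= b -> c <= y <= d -> continuous (fun t => p t y) x) ->
    (forall x y, a <= x <= b -> c <= y <= d -> continuous (fun t => q x t) y) ->
    Rabs (circulation p q a b c d) <= eps * ((b - a) + (d - c)) ^ 2.
Proof.
  intros He Hp Hq.
  assert (He2 : 0 < eps / 2) by lra.
  destruct (Hp (mkposreal _ He2)) as [d1 H1]; destruct (Hq (mkposreal _ He2)) as [d2 H2].
  simpl in H1, H2.
  exists (Rmin d1 d2); split; [apply Rmin_pos; apply cond_pos|].
  intros a b c d Hx Hy Hab Hcd Cp Cq.
  set (L := (b - a) + (d - c)).
  pose proof (Rmin_l d1 d2); pose proof (Rmin_r d1 d2).
  assert (Hmax : forall u v, a <= u <= b -> c <= v <= d -> Rmax (Rabs (u - x)) (Rabs (v - y)) <= L).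
  { intros u v Hu Hv; apply Rmax_lub; apply Rabs_le; unfold L; lra. }
  assert (Ep : forall u v, a <= u <= b -> c <= v <= d ->
    Rabs (p u v - p x y - (l * (u - x) + m * (v - y))) <= eps / 2 * L).
  { intros u v Hu Hv.
    assert (Hux : Rabs (u - x) < Rmin d1 d2) by (apply Rabs_def1; lra).
    assert (Hvy : Rabs (v - y) < Rmin d1 d2) by (apply Rabs_def1; lra).
    apply Rle_trans with (1 := H1 u v ltac:(lra) ltac:(lra)).
    apply Rmult_le_compat_l; [lra|]; apply Hmax; assumption. }
  assert (Eq : forall u v, a <= u <= b -> c <= v <= d ->
    Rabs (q u v - q x y - (m * (u - x) + k * (v - y))) <= eps / 2 * L).
  { intros u v Hu Hv.
    assert (Hux : Rabs (u - x) < Rmin d1 d2) by (apply Rabs_def1; lra).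
    assert (Hvy : Rabs (v - y) < Rmin d1 d2) by (apply Rabs_def1; lra).
    apply Rle_trans with (1 := H2 u v ltac:(lra) ltac:(lra)).
    apply Rmult_le_compat_l; [lra|]; apply Hmax; assumption. }
  assert (Ip : ex_RInt (fun u => p u c - p u d) a b).
  { apply (ex_RInt_continuous (V := R_CompleteNormedModule));
    intros z Hz; rewrite Rmin_left, Rmax_right in Hz by lra.
    apply (continuous_minus (V := R_NormedModule)); apply Cp; lra. }
  assert (Iq : ex_RInt (fun v => q b v - q a v) c d).
  { apply (ex_RInt_continuous (V := R_CompleteNormedModule));
    intros z Hz; rewrite Rmin_left, Rmax_right in Hz by lra.
    apply (continuous_minus (V := R_NormedModule)); apply Cq; lra. }
  assert (Bp : Rabs (RInt (fun u => p u c - p u d) a b - (- m * (d - c)) * (b - a)) <=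
               (b - a) * (eps * L)).
  { replace ((- m * (d - c)) * (b - a)) with (RInt (fun _ => - m * (d - c)) a b)
      by (rewrite RInt_const; unfold scal; simpl; unfold mult; simpl; ring).
    change (RInt (fun u => p u c - p u d) a b - RInt (fun _ => - m * (d - c)) a b)
      with (minus (RInt (fun u => p u c - p u d) a b) (RInt (fun _ => - m * (d - c)) a b)).
    rewrite <- RInt_minus; [|assumption|apply ex_RInt_const].
    apply abs_RInt_le_const; [lra| |].
    - apply (ex_RInt_minus (V := R_NormedModule)); [assumption|apply ex_RInt_const].
    - intros t Ht.
      generalize (Ep t c Ht ltac:(lra)) (Ep t d Ht ltac:(lra)); unfold minus, plus, opp; simpl.
      intros B1 B2; apply Rabs_le_between in B1; apply Rabs_le_between in B2; apply Rabs_le; lra. }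
  assert (Bq : Rabs (RInt (fun v => q b v - q a v) c d - (m * (b - a)) * (d - c)) <=
               (d - c) * (eps * L)).
  { replace ((m * (b - a)) * (d - c)) with (RInt (fun _ => m * (b - a)) c d)
      by (rewrite RInt_const; unfold scal; simpl; unfold mult; simpl; ring).
    change (RInt (fun v => q b v - q a v) c d - RInt (fun _ => m * (b - a)) c d)
      with (minus (RInt (fun v => q b v - q a v) c d) (RInt (fun _ => m * (b - a)) c d)).
    rewrite <- RInt_minus; [|assumption|apply ex_RInt_const].
    apply abs_RInt_le_const; [lra| |].
    - apply (ex_RInt_minus (V := R_NormedModule)); [assumption|apply ex_RInt_const].
    - intros t Ht.
      generalize (Eq b t ltac:(lra) Ht) (Eq a t ltac:(lra) Ht); unfold minus, plus, opp; simpl.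
      intros B1 B2; apply Rabs_le_between in B1; apply Rabs_le_between in B2; apply Rabs_le; lra. }
  unfold circulation; fold L.
  apply Rabs_le_between in Bp; apply Rabs_le_between in Bq; apply Rabs_le.
  replace (eps * L ^ 2) with ((b - a) * (eps * L) + (d - c) * (eps * L)) by (unfold L; ring).
  lra.
Qed.

(** Continuity of the partial derivatives is not available for a function that is only
    complex differentiable, so Green's formula is replaced by bisection: a non-zero
    circulation would persist, relative to the squared size, in ever smaller rectangles
    around one point, against the local estimate there. *)
Theorem goursat (p q : R -> R -> R) (a b c d : R) :
  a <= b -> c <= d ->
  (forall x y, a <= x <= b -> c <= y <= d -> exists l m k,
     differentiable_pt_lim p x y l m /\ differentiable_pt_lim q x y m k) ->
  circulation p q a b c d = 0.
Proof.
  intros Hab Hcd Hd.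
  assert (Cp : forall x y, a <= x <= b -> c <= y <= d -> continuous (fun t => p t y) x).
  { intros x y Hx Hy; destruct (Hd x y Hx Hy) as (l & m & k & H1 & _).
    apply (differentiable_continuous_x _ _ _ _ _ H1). }
  assert (Cq : forall x y, a <= x <= b -> c <= y <= d -> continuous (fun t => q x t) y).
  { intros x y Hx Hy; destruct (Hd x y Hx Hy) as (l & m & k & _ & H1).
    apply (differentiable_continuous_y _ _ _ _ _ H1). }
  destruct (Req_dec (circulation p q a b c d) 0) as [E|E]; [exact E|exfalso].
  apply Rabs_pos_lt in E.
  set (L := (b - a) + (d - c)).
  assert (HL : 0 < L).
  { destruct (Rle_lt_or_eq_dec 0 L ltac:(unfold L; lra)) as [H|H]; [exact H|exfalso].
    assert (a = b) by (unfold L in H; lra); assert (c = d) by (unfold L in H; lra); subst.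
    unfold circulation in E; rewrite !RInt_point in E.
    unfold zero in E; simpl in E; rewrite Rplus_0_r, Rabs_R0 in E; lra. }
  set (kap := Rabs (circulation p q a b c d) / L ^ 2).
  assert (HL2 : 0 < L ^ 2) by (apply pow_lt; lra).
  assert (Hk : 0 < kap) by (apply Rdiv_lt_0_compat; assumption).
  (* rectangles of size 0, where the two opposite estimates agree, are excluded *)
  destruct (bisection (fun a' b' c' d' => (a <= a' /\ b' <= b /\ c <= c' /\ d' <= d /\
        0 < (b' - a') + (d' - c'))
      /\ kap * ((b' - a') + (d' - c')) ^ 2 <= Rabs (circulation p q a' b' c' d')) a b c d)
    as (x & y & Hx & Hy & Hsm); [assumption|assumption| | |].
  - split; [unfold L in HL; lra|]; fold L; unfold kap; apply Req_le; field; lra.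
  - intros a1 b1 c1 d1 Hab1 Hcd1 [Hin HP].
    rewrite (circulation_split p q a1 b1 c1 d1 ((a1 + b1) / 2) ((c1 + d1) / 2)) in HP; try lra;
      try (intros; apply Cp; lra); try (intros; apply Cq; lra).
    set (m1 := (a1 + b1) / 2) in *; set (n1 := (c1 + d1) / 2) in *.
    set (L1 := (b1 - a1) + (d1 - c1)) in *.
    assert (Hq : kap * L1 ^ 2 <= Rabs (circulation p q a1 m1 c1 n1) +
      Rabs (circulation p q m1 b1 c1 n1) + Rabs (circulation p q a1 m1 n1 d1) +
      Rabs (circulation p q m1 b1 n1 d1)).
    { apply Rle_trans with (1 := HP).
      repeat (apply Rle_trans with (1 := Rabs_triang _ _); apply Rplus_le_compat_r).
      lra. }
    replace (kap * L1 ^ 2) with (4 * (kap * (L1 / 2) ^ 2)) in Hq by field.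
    assert (Em : m1 - a1 = (b1 - a1) / 2 /\ b1 - m1 = (b1 - a1) / 2) by (unfold m1; lra).
    assert (En : n1 - c1 = (d1 - c1) / 2 /\ d1 - n1 = (d1 - c1) / 2) by (unfold n1; lra).
    destruct Em as [Em1 Em2]; destruct En as [En1 En2].
    rewrite Em1, Em2, En1, En2.
    replace ((b1 - a1) / 2 + (d1 - c1) / 2) with (L1 / 2) by (unfold L1; field).
    assert (a1 <= m1 <= b1 /\ c1 <= n1 <= d1) by (unfold m1, n1; lra).
    destruct (Rle_dec (kap * (L1 / 2) ^ 2) (Rabs (circulation p q a1 m1 c1 n1))); [left; lra|right].
    destruct (Rle_dec (kap * (L1 / 2) ^ 2) (Rabs (circulation p q m1 b1 c1 n1))); [left; lra|right].
    destruct (Rle_dec (kap * (L1 / 2) ^ 2) (Rabs (circulation p q a1 m1 n1 d1))); [left; lra|right].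
    lra.
  - destruct (Hd x y Hx Hy) as (l & m & k & H1 & H2).
    destruct (circulation_local p q x y l m k (kap / 2) ltac:(lra) H1 H2) as (delta & Hdel & Hloc).
    destruct (Hsm delta Hdel) as (a' & b' & c' & d' & Ha & Hc & Hw1 & Hw2 & Hin & HP).
    specialize (Hloc a' b' c' d' ltac:(lra) ltac:(lra) Hw1 Hw2
      ltac:(intros; apply Cp; lra) ltac:(intros; apply Cq; lra)).
    assert (0 < kap * (b' - a' + (d' - c')) ^ 2)
      by (apply Rmult_lt_0_compat; [lra|apply pow_lt; lra]).
    lra.
Qed.

(** * Complex derivatives *)

Definition cdiff (f : C -> C) (z : C) : Prop :=
  ex_derive (K := C_AbsRing) (V := C_NormedModule) f z.

(** The derivative read in epsilon-delta form with the modulus: it hides that the two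
    normed-module structures on the complex numbers carry different uniform structures. *)
Definition cderiv (f : C -> C) (z l : C) : Prop :=
  forall eps, 0 < eps -> exists delta, 0 < delta /\
    forall w, Cmod (w - z) < delta ->
      Cmod (f w - f z - l * (w - z)) <= eps * Cmod (w - z).

Lemma cderiv_iff (f : C -> C) (z l : C) :
  is_derive (K := C_AbsRing) (V := C_NormedModule) f z l <-> cderiv f z l.
Proof.
  split.
  - intros [_ H] eps He.
    destruct (H z (fun P HP => HP) (mkposreal eps He)) as [delta Hd].
    exists delta; split; [apply cond_pos|intros w Hw].
    specialize (Hd w Hw).
    replace (f w - f z - l * (w - z))%C with (f w - f z - (w - z) * l)%C by ring.
    exact Hd.
  - intros H; split.
    + apply (is_linear_scal_l (K := C_AbsRing) (V := C_NormedModule)).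
    + intros x Hx.
      apply (is_filter_lim_locally_unique (K := C_AbsRing)
               (V := AbsRing_NormedModule C_AbsRing)) in Hx.
      subst x.
      intros eps; destruct (H eps (cond_pos eps)) as (delta & Hd & Hw).
      exists (mkposreal delta Hd); intros w Hb.
      specialize (Hw w Hb).
      replace (f w - f z - l * (w - z))%C with (f w - f z - (w - z) * l)%C in Hw by ring.
      exact Hw.
Qed.

Lemma cderiv_iff_ring (f : C -> C) (z l : C) :
  is_derive (K := C_AbsRing) (V := AbsRing_NormedModule C_AbsRing) f z l <-> cderiv f z l.
Proof.
  rewrite <- cderiv_iff; split; intros [_ H]; split; try exact H.
  - apply (is_linear_scal_l (K := C_AbsRing) (V := C_NormedModule)).
  - apply (is_linear_scal_l (K := C_AbsRing) (V := AbsRing_NormedModule C_AbsRing)).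
Qed.

Lemma cdiff_iff (f : C -> C) (z : C) : cdiff f z <-> exists l, cderiv f z l.
Proof.
  split; intros [l H]; exists l; apply cderiv_iff; exact H.
Qed.

Definition ccont (f : C -> C) (z : C) : Prop :=
  forall eps, 0 < eps -> exists delta, 0 < delta /\
    forall w, Cmod (w - z) < delta -> Cmod (f w - f z) < eps.

Lemma cdiff_ccont (f : C -> C) (z : C) : cdiff f z -> ccont f z.
Proof.
  intros [l H]%cdiff_iff eps He.
  destruct (H 1 ltac:(lra)) as (d & Hd & Hw).
  pose proof (Cmod_ge_0 l).
  set (e := eps / (Cmod l + 2)).
  assert (Hee : 0 < e) by (apply Rdiv_lt_0_compat; lra).
  exists (Rmin d e); split; [apply Rmin_pos; assumption|].
  intros w Hlt.
  pose proof (Rmin_l d e); pose proof (Rmin_r d e).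
  specialize (Hw w ltac:(lra)).
  replace (f w - f z)%C with ((f w - f z - l * (w - z)) + l * (w - z))%C by ring.
  apply Rle_lt_trans with (1 := Cmod_triangle _ _).
  rewrite Cmod_mult.
  pose proof (Cmod_ge_0 (w - z)).
  apply Rle_lt_trans with ((Cmod l + 1) * Cmod (w - z)); [nra|].
  apply Rle_lt_trans with ((Cmod l + 1) * e); [apply Rmult_le_compat_l; lra|].
  replace eps with ((Cmod l + 2) * e) by (unfold e; field; lra).
  nra.
Qed.

Lemma cdiff_const (c z : C) : cdiff (fun _ => c) z.
Proof. apply (ex_derive_const (K := C_AbsRing) (V := C_NormedModule)). Qed.

Lemma cdiff_id (z : C) : cdiff (fun w => w) z.
Proof.
  apply cdiff_iff; exists 1; apply cderiv_iff_ring, (is_derive_id (K := C_AbsRing)).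
Qed.

Lemma cdiff_plus (f g : C -> C) (z : C) :
  cdiff f z -> cdiff g z -> cdiff (fun w => f w + g w)%C z.
Proof. apply (ex_derive_plus (K := C_AbsRing) (V := C_NormedModule)). Qed.

Lemma cdiff_minus (f g : C -> C) (z : C) :
  cdiff f z -> cdiff g z -> cdiff (fun w => f w - g w)%C z.
Proof. apply (ex_derive_minus (K := C_AbsRing) (V := C_NormedModule)). Qed.

Lemma cdiff_mult (f g : C -> C) (z : C) :
  cdiff f z -> cdiff g z -> cdiff (fun w => f w * g w)%C z.
Proof.
  intros [l Hf]%cdiff_iff [m Hg]%cdiff_iff; apply cdiff_iff; exists (l * g z + f z * m)%C.
  apply cderiv_iff_ring in Hf; apply cderiv_iff_ring in Hg; apply cderiv_iff_ring.
  apply (is_derive_mult (K := C_AbsRing) f g z l m Hf Hg Cmult_comm).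
Qed.

Lemma cdiff_comp (f g : C -> C) (z : C) :
  cdiff f (g z) -> cdiff g z -> cdiff (fun w => f (g w)) z.
Proof.
  intros [l Hf] [m Hg]%cdiff_iff; exists (m * l)%C.
  apply cderiv_iff_ring in Hg.
  apply (is_derive_comp (K := C_AbsRing) (V := C_NormedModule) f g z l m Hf Hg).
Qed.

Lemma cdiff_ext_loc (f g : C -> C) (z : C) (delta : R) :
  0 < delta -> (forall w, Cmod (w - z) < delta -> f w = g w) -> cdiff f z -> cdiff g z.
Proof.
  intros Hd He; apply (ex_derive_ext_loc (K := C_AbsRing) (V := C_NormedModule)).
  exists (mkposreal delta Hd); exact He.
Qed.

Lemma Cmod_pos (z : C) : z <> 0 -> 0 < Cmod z.
Proof. apply Cmod_gt_0. Qed.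

Lemma Cmod_minus_sym (z w : C) : Cmod (z - w) = Cmod (w - z).
Proof. rewrite <- Cmod_opp; f_equal; ring. Qed.

Lemma Cmod_triangle_rev (z w : C) : Cmod z - Cmod w <= Cmod (z - w).
Proof.
  pose proof (Cmod_triangle (z - w) w) as H.
  replace (z - w + w)%C with z in H by ring; lra.
Qed.

Lemma Cminus_neq0 (z w : C) : z <> w -> (z - w)%C <> 0.
Proof.
  intros H E; apply H; replace z with (z - w + w)%C by ring; rewrite E; ring.
Qed.

Lemma cdiff_inv_id (z : C) : z <> 0 -> cdiff Cinv z.
Proof.
  intros Hz; apply cdiff_iff; exists (- / (z * z))%C; intros eps He.
  pose proof (Cmod_pos z Hz) as Hp; set (m := Cmod z) in *.
  set (e := eps * (m * m * m) / 2).
  assert (Hee : 0 < e) by (unfold e; assert (0 < m * m * m)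
    by (repeat apply Rmult_lt_0_compat; lra); nra).
  exists (Rmin (m / 2) e); split; [apply Rmin_pos; lra|].
  intros w Hw.
  pose proof (Rmin_l (m / 2) e); pose proof (Rmin_r (m / 2) e).
  assert (Hm : m / 2 < Cmod w).
  { pose proof (Cmod_triangle_rev z w) as H1; rewrite Cmod_minus_sym in H1; fold m in H1; lra. }
  assert (Hw0 : w <> 0) by (intros ->; rewrite Cmod_0 in Hm; lra).
  replace (/ w - / z - - / (z * z) * (w - z))%C
    with ((w - z) * (w - z) / (z * z * w))%C by (field; split; assumption).
  rewrite Cmod_div by (repeat apply Cmult_neq_0; assumption).
  rewrite !Cmod_mult; fold m.
  assert (0 < m * m * Cmod w) by (repeat apply Rmult_lt_0_compat; lra).
  apply Rle_div_l; [lra|].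
  pose proof (Cmod_ge_0 (w - z)).
  rewrite (Rmult_comm eps), Rmult_assoc.
  apply Rmult_le_compat_l; [assumption|].
  apply Rle_trans with e; [lra|].
  unfold e.
  replace (eps * (m * m * m) / 2) with (eps * (m * m * (m / 2))) by field.
  apply Rmult_le_compat_l; [lra|]; apply Rmult_le_compat_l; [nra|lra].
Qed.

Lemma cdiff_inv (f : C -> C) (z : C) :
  f z <> 0 -> cdiff f z -> cdiff (fun w => / f w)%C z.
Proof.
  intros H0 Hf; apply (cdiff_comp Cinv f z); [apply cdiff_inv_id|]; assumption.
Qed.

Lemma cdiff_div (f g : C -> C) (z : C) :
  g z <> 0 -> cdiff f z -> cdiff g z -> cdiff (fun w => f w / g w)%C z.
Proof.
  intros H0 Hf Hg; apply cdiff_mult; [|apply cdiff_inv]; assumption.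
Qed.

(** * The mean value property *)

(** The Cauchy-Riemann equations. *)
Lemma cderiv_components (f : C -> C) (x y : R) (l : C) :
  cderiv f (x, y) l ->
    differentiable_pt_lim (fun u v => Re (f (u, v))) x y (Re l) (- Im l) /\
    differentiable_pt_lim (fun u v => Im (f (u, v))) x y (Im l) (Re l).
Proof.
  intros H.
  assert (H2 : forall eps : posreal, exists delta : posreal, forall u v,
    Rabs (u - x) < delta -> Rabs (v - y) < delta ->
    Cmod (f (u, v) - f (x, y) - l * ((u, v) - (x, y))) <= eps * Rmax (Rabs (u - x)) (Rabs (v - y))).
  { intros eps.
    assert (Hs : 0 < sqrt 2) by (apply sqrt_lt_R0; lra).
    destruct (H (eps / sqrt 2)) as (d & Hd & Hw).
    { apply Rdiv_lt_0_compat; [apply cond_pos|exact Hs]. }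
    assert (Hd2 : 0 < d / sqrt 2) by (apply Rdiv_lt_0_compat; assumption).
    exists (mkposreal _ Hd2); intros u v Hu Hv; simpl in Hu, Hv.
    assert (Hc : Cmod ((u, v) - (x, y)) <= sqrt 2 * Rmax (Rabs (u - x)) (Rabs (v - y))).
    { apply (Cmod_2Rmax ((u, v) - (x, y))%C). }
    assert (Hlt : Cmod ((u, v) - (x, y)) < d).
    { apply Rle_lt_trans with (1 := Hc).
      apply Rlt_le_trans with (sqrt 2 * (d / sqrt 2)).
      - apply Rmult_lt_compat_l; [exact Hs|]; apply Rmax_lub_lt; assumption.
      - apply Req_le; field; lra. }
    apply Rle_trans with (1 := Hw (u, v) Hlt).
    apply Rle_trans with (eps / sqrt 2 * (sqrt 2 * Rmax (Rabs (u - x)) (Rabs (v - y)))).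
    - apply Rmult_le_compat_l; [|exact Hc].
      apply Rlt_le, Rdiv_lt_0_compat; [apply cond_pos|exact Hs].
    - apply Req_le; field; lra. }
  split; intros eps; destruct (H2 eps) as [d Hd]; exists d; intros u v Hu Hv;
    specialize (Hd u v Hu Hv); apply Rle_trans with (2 := Hd);
    match goal with |- _ <= Cmod ?w => generalize (Rmax_Cmod w); set (t := w) end; intros Hm.
  - apply Rle_trans with (Rabs (fst t)).
    + apply Req_le; f_equal; unfold t; destruct (f (u, v)), (f (x, y)), l; simpl; ring.
    + apply Rle_trans with (2 := Hm); apply Rmax_l.
  - apply Rle_trans with (Rabs (snd t)).
    + apply Req_le; f_equal; unfold t; destruct (f (u, v)), (f (x, y)), l; simpl; ring.
    + apply Rle_trans with (2 := Hm); apply Rmax_r.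
Qed.

Lemma differentiable_snd (g : R -> R) (x y l : R) :
  derivable_pt_lim g y l -> differentiable_pt_lim (fun _ v => g v) x y 0 l.
Proof.
  intros H eps.
  destruct (differentiable_pt_lim_proj1_0 g y x l H eps) as [d Hd].
  exists d; intros u v Hu Hv.
  specialize (Hd v u Hv Hu); simpl in Hd.
  rewrite Rmax_comm.
  replace (g v - g y - (0 * (u - x) + l * (v - y)))
    with (g v - g y - (l * (v - y) + 0 * (u - x))) by ring.
  exact Hd.
Qed.

Lemma differentiable_affine_mult (k a b : R) :
  differentiable_pt_lim (fun u v => k + u * v) a b b a.
Proof.
  intros eps; exists eps; intros u v Hu Hv.
  replace (k + u * v - (k + a * b) - (b * (u - a) + a * (v - b)))
    with ((u - a) * (v - b)) by ring.
  rewrite Rabs_mult.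
  apply Rmult_le_compat; try apply Rabs_pos; [lra|apply Rmax_r].
Qed.

Definition polar (z : C) (r th : R) : C := (fst z + r * cos th, snd z + r * sin th).

Lemma Cmod_polar (z : C) (r th : R) : 0 <= r -> Cmod (polar z r th - z) = r.
Proof.
  intros Hr.
  replace (polar z r th - z)%C with (r * cos th, r * sin th)
    by (unfold polar, Cminus, Cplus, Copp; simpl; f_equal; ring).
  unfold Cmod; simpl.
  replace (r * cos th * (r * cos th * 1) + r * sin th * (r * sin th * 1))
    with (r ^ 2 * (Rsqr (sin th) + Rsqr (cos th))) by (unfold Rsqr; ring).
  rewrite sin2_cos2, Rmult_1_r; apply sqrt_pow2; exact Hr.
Qed.

Lemma polar_differentiable (k s th : R) (g : R -> R) (l : R) :
  derivable_pt_lim g th l ->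
  differentiable_pt_lim (fun s th => k + exp s * g th) s th (exp s * g th) (exp s * l).
Proof.
  intros Hg.
  replace (exp s * g th) with (g th * exp s + exp s * 0) by ring.
  replace (exp s * l) with (g th * 0 + exp s * l) by ring.
  apply (differentiable_pt_lim_comp (fun u v => k + u * v) (fun s _ => exp s) (fun _ th => g th)).
  - apply differentiable_affine_mult.
  - apply differentiable_pt_lim_proj1_0, derivable_pt_lim_exp.
  - apply differentiable_snd, Hg.
Qed.

(** In the coordinate s + i th with w = z + exp (s + i th) a holomorphic function
    stays holomorphic, so Im ds + Re dth is a closed form. *)
Lemma polar_components_differentiable (f : C -> C) (z : C) (s th : R) :
  cdiff f (polar z (exp s) th) -> exists l m k,
    differentiable_pt_lim (fun s th => Im (f (polar z (exp s) th))) s th l m /\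
    differentiable_pt_lim (fun s th => Re (f (polar z (exp s) th))) s th m k.
Proof.
  intros [l H]%cdiff_iff; destruct (cderiv_components f _ _ l H) as [H1 H2].
  set (al := Re l) in *; set (be := Im l) in *.
  pose proof (polar_differentiable (fst z) s th cos _ (derivable_pt_lim_cos th)) as HX.
  pose proof (polar_differentiable (snd z) s th sin _ (derivable_pt_lim_sin th)) as HY.
  eexists; exists (be * (exp s * - sin th) + al * (exp s * cos th)); eexists; split.
  - apply (differentiable_pt_lim_comp (fun u v => Im (f (u, v)))
      (fun s th => fst z + exp s * cos th) (fun s th => snd z + exp s * sin th)
      s th _ _ _ _ _ _ H2 HX HY).
  - replace (be * (exp s * - sin th) + al * (exp s * cos th))
      with (al * (exp s * cos th) + (- be) * (exp s * sin th)) by ring.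
    apply (differentiable_pt_lim_comp (fun u v => Re (f (u, v)))
      (fun s th => fst z + exp s * cos th) (fun s th => snd z + exp s * sin th)
      s th _ _ _ _ _ _ H1 HX HY).
Qed.

(** The form Im ds + Re dth on the rectangle [s0, s1] x [0, 2 PI]: the two sides th = 0
    and th = 2 PI cancel by periodicity. *)
Lemma circle_integral_constant (f : C -> C) (z : C) (s0 s1 : R) :
  s0 <= s1 ->
  (forall w, exp s0 <= Cmod (w - z) <= exp s1 -> cdiff f w) ->
  RInt (fun th => Re (f (polar z (exp s0) th))) 0 (2 * PI) =
  RInt (fun th => Re (f (polar z (exp s1) th))) 0 (2 * PI) /\
  ex_RInt (fun th => Re (f (polar z (exp s0) th))) 0 (2 * PI).
Proof.
  intros Hs Hf.
  pose proof PI_RGT_0 as Hpi.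
  set (p := fun s th => Im (f (polar z (exp s) th))).
  set (q := fun s th => Re (f (polar z (exp s) th))).
  assert (Hd : forall s th, s0 <= s <= s1 -> 0 <= th <= 2 * PI -> exists l m k,
     differentiable_pt_lim p s th l m /\ differentiable_pt_lim q s th m k).
  { intros s th Hss _; apply polar_components_differentiable, Hf.
    rewrite Cmod_polar by (apply Rlt_le, exp_pos).
    assert (Hle : forall a b, a <= b -> exp a <= exp b).
    { intros a b [Hl|E]; [apply Rlt_le, exp_increasing, Hl|rewrite E; lra]. }
    split; apply Hle; lra. }
  assert (Iq : forall s, s0 <= s <= s1 -> ex_RInt (q s) 0 (2 * PI)).
  { intros s Hss; apply (ex_RInt_continuous (V := R_CompleteNormedModule)).
    intros th Hth; rewrite Rmin_left, Rmax_right in Hth by lra.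
    destruct (Hd s th Hss Hth) as (l & m & k & _ & H).
    apply (differentiable_continuous_y _ _ _ _ _ H). }
  split; [|apply (Iq s0); lra].
  pose proof (goursat p q s0 s1 0 (2 * PI) Hs ltac:(lra) Hd) as G.
  unfold circulation in G.
  rewrite (RInt_ext _ (fun _ => 0)) in G.
  2:{ intros x _; unfold p, polar; rewrite cos_2PI, sin_2PI, cos_0, sin_0.
      apply Rminus_diag_eq; reflexivity. }
  rewrite RInt_const in G.
  pose proof (RInt_minus (V := R_CompleteNormedModule) (q s1) (q s0) 0 (2 * PI)
    (Iq s1 ltac:(lra)) (Iq s0 ltac:(lra))) as E.
  unfold minus, plus, opp in E; simpl in E.
  unfold scal in G; simpl in G; unfold mult in G; simpl in G.
  fold (q s0); fold (q s1); unfold Rminus in G; lra.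
Qed.

(** Letting the inner circle shrink to the center gives the mean value property. Only
    continuity is asked at the center itself, because the quotient in Schwarz's lemma has a
    removable singularity there. *)
Lemma submean (f : C -> C) (z : C) (rho r M : R) :
  0 < r < rho ->
  (forall w, w <> z -> Cmod (w - z) < rho -> cdiff f w) ->
  ccont f z ->
  (forall th, 0 <= th <= 2 * PI -> Re (f (polar z r th)) <= M) ->
  Re (f z) <= M.
Proof.
  intros Hr Hf Hc HM.
  pose proof PI_RGT_0 as Hpi.
  apply le_epsilon; intros eps He.
  destruct (Hc eps He) as (d & Hd & Hw).
  set (r0 := Rmin r (d / 2)).
  assert (H0 : 0 < r0) by (apply Rmin_pos; lra).
  pose proof (Rmin_l r (d / 2)) as Hl; pose proof (Rmin_r r (d / 2)) as Hl2; fold r0 in Hl, Hl2.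
  assert (Hs : ln r0 <= ln r).
  { destruct Hl as [Hl|Hl]; [apply Rlt_le, ln_increasing; assumption|rewrite Hl; lra]. }
  assert (Hh : forall w, r0 <= Cmod (w - z) <= r -> cdiff f w).
  { intros w Hwz; apply Hf; [|lra].
    intros ->; replace (z - z)%C with (RtoC 0) in Hwz by ring; rewrite Cmod_0 in Hwz; lra. }
  destruct (circle_integral_constant f z (ln r0) (ln r) Hs) as [E I0].
  { intros w; rewrite !exp_ln by lra; apply Hh. }
  destruct (circle_integral_constant f z (ln r) (ln r) ltac:(lra)) as [_ I1].
  { intros w; rewrite !exp_ln by lra; intros Hwz; apply Hh; lra. }
  rewrite (exp_ln r), (exp_ln r0) in * by lra.
  assert (B1 : RInt (fun th => Re (f (polar z r th))) 0 (2 * PI) <= RInt (fun _ => M) 0 (2 * PI)).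
  { apply RInt_le; [lra|exact I1|apply ex_RInt_const|].
    intros th Hth; apply HM; lra. }
  assert (B0 : RInt (fun _ => Re (f z) - eps) 0 (2 * PI) <=
               RInt (fun th => Re (f (polar z r0 th))) 0 (2 * PI)).
  { apply RInt_le; [lra|apply ex_RInt_const|exact I0|].
    intros th _.
    assert (Hlt : Cmod (polar z r0 th - z) < d) by (rewrite Cmod_polar; lra).
    specialize (Hw _ Hlt).
    pose proof (re_le_Cmod (f (polar z r0 th) - f z)) as Hre.
    assert (E2 : Re (f (polar z r0 th) - f z) = Re (f (polar z r0 th)) - Re (f z)) by reflexivity.
    rewrite E2 in Hre; apply Rabs_le_between in Hre; lra. }
  rewrite RInt_const in B0, B1.
  unfold scal in B0, B1; simpl in B0, B1; unfold mult in B0, B1; simpl in B0, B1.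
  assert (2 * PI * (Re (f z) - eps) <= 2 * PI * M) by lra.
  apply Rmult_le_reg_l in H; lra.
Qed.

(** * Univalent functions: openness and compactness *)

Lemma disc_ball (z w : C) : disc z -> Cmod (w - z) < 1 - Cmod z -> disc w.
Proof.
  unfold disc; intros Hz Hw.
  pose proof (Cmod_triangle_rev w z); lra.
Qed.

Lemma circle_min (f : C -> C) (z : C) (r : R) :
  0 < r -> (forall th, cdiff f (polar z r th)) ->
  (forall th, f (polar z r th) <> 0) ->
  exists m, 0 < m /\ forall th, 0 <= th <= 2 * PI -> m <= Cmod (f (polar z r th)).
Proof.
  intros Hr Hf Hn.
  pose proof PI_RGT_0 as Hpi.
  set (g := fun th => Re (f (polar z r th)) * Re (f (polar z r th)) +
                      Im (f (polar z r th)) * Im (f (polar z r th))).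
  assert (Eg : forall th, g th = Cmod (f (polar z r th)) ^ 2).
  { intros th; rewrite Cmod2_alt; unfold g; ring. }
  destruct (continuity_ab_min g 0 (2 * PI)) as (t0 & Hmin & Ht0); [lra| |].
  - intros th _.
    destruct (polar_components_differentiable f z (ln r) th) as (l & m & k & H1 & H2).
    { rewrite exp_ln by lra; apply Hf. }
    apply differentiable_continuous_y in H1; apply differentiable_continuous_y in H2.
    rewrite exp_ln in H1, H2 by lra.
    apply continuity_pt_filterlim.
    apply (continuous_plus (V := R_NormedModule));
      apply (continuous_mult (K := R_AbsRing)); assumption.
  - exists (Cmod (f (polar z r t0))); split.
    + apply Cmod_pos, Hn.
    + intros th Hth; specialize (Hmin th Hth); rewrite !Eg in Hmin.
      pose proof (Cmod_ge_0 (f (polar z r t0))); pose proof (Cmod_ge_0 (f (polar z r th))).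
      nra.
Qed.

Lemma Re_conj_mult (z : C) : Re (Cconj z * z) = Cmod z ^ 2.
Proof. rewrite Cmod2_alt; destruct z; simpl; ring. Qed.

Lemma Re_conj_mult_le (z w : C) : Re (Cconj z * w) <= Cmod z * Cmod w.
Proof.
  pose proof (re_le_Cmod (Cconj z * w)) as H.
  rewrite Cmod_mult, Cmod_conj in H.
  apply Rle_trans with (2 := H); apply Rle_abs.
Qed.

(** If a value w close to b z were omitted near z, then 1 / (b - w) would be larger at z
    than on a surrounding circle, on which b stays away from b z by injectivity. *)
Lemma univalent_open (b : C -> C) (z : C) (delta : R) :
  univalent_on disc b -> disc z -> 0 < delta ->
  exists eta, 0 < eta /\ forall w, Cmod (w - b z) < eta ->
    exists z', disc z' /\ Cmod (z' - z) < delta /\ b z' = w.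
Proof.
  intros [Hb Hinj] Hz Hd.
  set (rho := Rmin delta (1 - Cmod z)).
  assert (Hrho : 0 < rho) by (apply Rmin_pos; [|unfold disc in Hz]; lra).
  assert (Hdisc : forall w, Cmod (w - z) < rho -> disc w).
  { intros w Hw; apply (disc_ball z); [exact Hz|].
    apply Rlt_le_trans with (1 := Hw), Rmin_r. }
  assert (Hpol : forall th, Cmod (polar z (rho / 2) th - z) = rho / 2)
    by (intros th; apply Cmod_polar; lra).
  destruct (circle_min (fun w => b w - b z)%C z (rho / 2)) as (m & Hm & Hmin); [lra| | |].
  - intros th; apply cdiff_minus; [|apply cdiff_const].
    apply Hb, Hdisc; rewrite Hpol; lra.
  - intros th; apply Cminus_neq0; intros E.
    specialize (Hpol th); apply Hinj in E; [|apply Hdisc; rewrite Hpol; lra|exact Hz].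
    rewrite E in Hpol; replace (z - z)%C with (RtoC 0) in Hpol by ring.
    rewrite Cmod_0 in Hpol; lra.
  - exists (m / 2); split; [lra|]; intros w Hw.
    apply NNPP; intros Hno.
    assert (Hnw : forall x, Cmod (x - z) < rho -> (b x - w)%C <> 0).
    { intros x Hx; apply Cminus_neq0; intros E; apply Hno; exists x.
      split; [apply Hdisc, Hx|split; [|exact E]].
      apply Rlt_le_trans with (1 := Hx), Rmin_l. }
    assert (Hzz : Cmod (z - z) < rho).
    { replace (z - z)%C with (RtoC 0) by ring; rewrite Cmod_0; exact Hrho. }
    set (u := fun x => (/ (b x - w))%C).
    assert (Hu : forall x, Cmod (x - z) < rho -> cdiff u x).
    { intros x Hx; apply cdiff_inv; [apply Hnw, Hx|].
      apply cdiff_minus; [apply Hb, Hdisc, Hx|apply cdiff_const]. }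
    assert (Huz : 2 / m < Cmod (u z)).
    { unfold u; rewrite Cmod_inv by (apply Hnw, Hzz).
      replace (2 / m) with (/ (m / 2)) by (field; lra).
      rewrite Cmod_minus_sym in Hw.
      apply Rinv_lt_contravar; [|exact Hw].
      apply Rmult_lt_0_compat; [apply Cmod_pos, Hnw, Hzz|lra]. }
    assert (Hcu : forall x, Cmod (x - z) < rho -> cdiff (fun x => Cconj (u z) * u x)%C x).
    { intros x Hx; apply cdiff_mult; [apply cdiff_const|apply Hu, Hx]. }
    pose proof (submean (fun x => Cconj (u z) * u x)%C z rho (rho / 2) (Cmod (u z) * (2 / m))) as S.
    cbv beta in S; rewrite Re_conj_mult in S.
    assert (0 < 2 / m) by (apply Rdiv_lt_0_compat; lra).
    enough (Cmod (u z) ^ 2 <= Cmod (u z) * (2 / m)) by nra.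
    apply S.
    + lra.
    + intros x _; apply Hcu.
    + apply cdiff_ccont, Hcu, Hzz.
    + intros th Hth; apply Rle_trans with (1 := Re_conj_mult_le _ _).
      apply Rmult_le_compat_l; [apply Cmod_ge_0|].
      specialize (Hmin th Hth); simpl in Hmin.
      unfold u; rewrite Cmod_inv by (apply Hnw; rewrite Hpol; lra).
      replace (2 / m) with (/ (m / 2)) by (field; lra).
      apply Rinv_le_contravar; [lra|].
      pose proof (Cmod_triangle_rev (b (polar z (rho / 2) th) - b z) (w - b z)) as T.
      replace (b (polar z (rho / 2) th) - b z - (w - b z))%C
        with (b (polar z (rho / 2) th) - w)%C in T by ring.
      lra.
Qed.

(** The set where |b| <= rho is the image of a closed disc under the inverse of b, hence
    compact. The inverse is never named: the bisection takes place in the target plane,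
    and [univalent_open] transfers closeness back to the disc. *)
Lemma max_attained (b : C -> C) (rho : R) (psi : C -> R) :
  univalent_on disc b -> 0 <= rho ->
  (forall w, Cmod w <= rho -> image b disc w) ->
  (forall z, disc z -> forall eps, 0 < eps -> exists delta, 0 < delta /\
     forall w, Cmod (w - z) < delta -> psi w < psi z + eps) ->
  exists z1, disc z1 /\ Cmod (b z1) <= rho /\
    forall z, disc z -> Cmod (b z) <= rho -> psi z <= psi z1.
Proof.
  intros Hb Hrho Himg Hpsi.
  (* rectangles in which psi o b^-1 comes up to every one of its values *)
  destruct (bisection (fun a a' c c' => forall x, disc x -> Cmod (b x) <= rho ->
      exists y, disc y /\ Cmod (b y) <= rho /\ a <= Re (b y) <= a' /\ c <= Im (b y) <= c' /\
        psi x <= psi y) (- rho) rho (- rho) rho) as (s & t & _ & _ & Hsm).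
  - lra.
  - lra.
  - intros x Hx Hbx; exists x.
    pose proof (Rmax_Cmod (b x)) as Hm.
    pose proof (Rmax_l (Rabs (fst (b x))) (Rabs (snd (b x)))).
    pose proof (Rmax_r (Rabs (fst (b x))) (Rabs (snd (b x)))).
    assert (H1 : Rabs (fst (b x)) <= rho) by lra.
    assert (H2 : Rabs (snd (b x)) <= rho) by lra.
    apply Rabs_le_between in H1; apply Rabs_le_between in H2.
    unfold Re, Im; repeat split; try assumption; lra.
  - intros a a' c c' Ha Hc HP.
    apply NNPP; intros Hno.
    apply not_or_and in Hno; destruct Hno as [N1 Hno].
    apply not_or_and in Hno; destruct Hno as [N2 Hno].
    apply not_or_and in Hno; destruct Hno as [N3 N4].
    assert (Hescape : forall a a' c c', ~ (forall x, disc x -> Cmod (b x) <= rho ->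
       exists y, disc y /\ Cmod (b y) <= rho /\ a <= Re (b y) <= a' /\ c <= Im (b y) <= c' /\
        psi x <= psi y) ->
       exists x, disc x /\ Cmod (b x) <= rho /\
         forall y, disc y -> Cmod (b y) <= rho -> a <= Re (b y) <= a' /\ c <= Im (b y) <= c' ->
         psi y < psi x).
    { intros s s' t t' HQ; apply NNPP; intros Hn; apply HQ; intros x Hx Hbx.
      apply NNPP; intros Hn2; apply Hn; exists x; repeat split; try assumption.
      intros y Hy Hby [Q1 Q2]; apply Rnot_le_lt; intros Hle; apply Hn2; exists y; auto. }
    apply Hescape in N1; apply Hescape in N2; apply Hescape in N3; apply Hescape in N4.
    destruct N1 as (x1 & D1 & B1 & M1); destruct N2 as (x2 & D2 & B2 & M2).
    destruct N3 as (x3 & D3 & B3 & M3); destruct N4 as (x4 & D4 & B4 & M4).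
    assert (HX : exists x, disc x /\ Cmod (b x) <= rho /\ psi x1 <= psi x /\ psi x2 <= psi x /\
               psi x3 <= psi x /\ psi x4 <= psi x).
    { destruct (Rle_dec (psi x1) (psi x2)); destruct (Rle_dec (psi x3) (psi x4)).
      - destruct (Rle_dec (psi x2) (psi x4)); [exists x4|exists x2]; repeat split; try assumption; lra.
      - destruct (Rle_dec (psi x2) (psi x3)); [exists x3|exists x2]; repeat split; try assumption; lra.
      - destruct (Rle_dec (psi x1) (psi x4)); [exists x4|exists x1]; repeat split; try assumption; lra.
      - destruct (Rle_dec (psi x1) (psi x3)); [exists x3|exists x1]; repeat split; try assumption; lra. }
    destruct HX as (x & Dx & Bx & L1 & L2 & L3 & L4).
    destruct (HP x Dx Bx) as (y & Dy & By & Y1 & Y2 & Y3).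
    specialize (M1 y Dy By); specialize (M2 y Dy By); specialize (M3 y Dy By); specialize (M4 y Dy By).
    destruct (Rle_dec (Re (b y)) ((a + a') / 2)); destruct (Rle_dec (Im (b y)) ((c + c') / 2)).
    + specialize (M1 ltac:(split; lra)); lra.
    + specialize (M3 ltac:(split; lra)); lra.
    + specialize (M2 ltac:(split; lra)); lra.
    + specialize (M4 ltac:(split; lra)); lra.
  - assert (Hnear : forall delta, 0 < delta -> forall x, disc x -> Cmod (b x) <= rho ->
       exists y, disc y /\ Cmod (b y) <= rho /\ Cmod (b y - (s, t)) < delta /\ psi x <= psi y).
    { intros delta Hdel x Hx Hbx.
      assert (Hdel2 : 0 < delta / sqrt 2) by (apply Rdiv_lt_0_compat;
        [assumption|apply sqrt_lt_R0; lra]).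
      destruct (Hsm _ Hdel2) as (a & a' & c & c' & Ha & Hc & W1 & W2 & HP).
      destruct (HP x Hx Hbx) as (y & Dy & By & Y1 & Y2 & Y3).
      exists y; repeat split; try assumption.
      apply Rle_lt_trans with (1 := Cmod_2Rmax _).
      assert (Hs2 : 0 < sqrt 2) by (apply sqrt_lt_R0; lra).
      apply Rlt_le_trans with (sqrt 2 * (delta / sqrt 2)); [|apply Req_le; field; lra].
      apply Rmult_lt_compat_l; [exact Hs2|].
      unfold Re, Im in Y1, Y2.
      apply Rmax_lub_lt; apply Rabs_def1; simpl; lra. }
    assert (Hst : Cmod (s, t) <= rho).
    { apply le_epsilon; intros eps He.
      destruct (Himg 0) as (x & Hx & Hbx); [rewrite Cmod_0; exact Hrho|].
      destruct (Hnear eps He x Hx) as (y & _ & By & Hy & _).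
      { rewrite Hbx, Cmod_0; exact Hrho. }
      rewrite Cmod_minus_sym in Hy.
      pose proof (Cmod_triangle_rev (s, t) (b y)); lra. }
    destruct (Himg _ Hst) as (z1 & Hz1 & Hbz1).
    exists z1; split; [exact Hz1|split; [rewrite Hbz1; exact Hst|]].
    intros x Hx Hbx; apply le_epsilon; intros eps He.
    destruct (Hpsi z1 Hz1 eps He) as (delta & Hdel & Hps).
    destruct (univalent_open b z1 delta Hb Hz1 Hdel) as (eta & Heta & Hop).
    destruct (Hnear eta Heta x Hx Hbx) as (y & Dy & By & Hy & Hxy).
    destruct (Hop (b y)) as (y' & Dy' & Hy' & E); [rewrite Hbz1; exact Hy|].
    destruct Hb as [_ Hinj]; apply Hinj in E; [subst y'|assumption|assumption].
    specialize (Hps y Hy'); lra.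
Qed.

(** * Schwarz's lemma and subordination *)

(** A function whose derivative vanishes on a disc is constant on its segments, hence not
    injective. [schwarz_univalent] is applied at the points found here, from which
    [subordination] reaches all others by continuity. *)
Lemma univalent_deriv_dense (b : C -> C) (z0 : C) (delta : R) :
  univalent_on disc b -> disc z0 -> 0 < delta ->
  exists z1 l, disc z1 /\ Cmod (z1 - z0) < delta /\ cderiv b z1 l /\ l <> 0.
Proof.
  intros [Hb Hinj] Hz Hd.
  apply NNPP; intros Hno.
  set (rho := Rmin delta (1 - Cmod z0)).
  assert (Hrho : 0 < rho) by (apply Rmin_pos; [|unfold disc in Hz]; lra).
  set (pt := fun t : R => (fst z0 + t, snd z0)).
  assert (Hdist : forall t, 0 <= t <= rho / 2 -> Cmod ((pt t) - z0) < rho).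
  { intros t Ht.
    replace (pt t - z0)%C with (RtoC t)
      by (unfold pt; destruct z0; unfold RtoC, Cminus, Cplus, Copp; simpl; f_equal; ring).
    rewrite Cmod_R, Rabs_pos_eq; lra. }
  assert (Hdisc : forall w, Cmod (w - z0) < rho -> disc w).
  { intros w Hw; apply (disc_ball z0); [exact Hz|].
    apply Rlt_le_trans with (1 := Hw), Rmin_r. }
  assert (Hder : forall t, 0 <= t <= rho / 2 ->
     derivable_pt_lim (fun t => Re (b (pt t))) t 0 /\
     derivable_pt_lim (fun t => Im (b (pt t))) t 0).
  { intros t Ht.
    assert (Hc : cderiv b (pt t) 0).
    { destruct (proj1 (cdiff_iff _ _) (Hb _ (Hdisc _ (Hdist t Ht)))) as [l Hl].
      destruct (classic (l = 0)) as [E|E]; [rewrite <- E; exact Hl|exfalso].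
      apply Hno; exists (pt t), l; repeat split; try assumption.
      - apply Hdisc, Hdist, Ht.
      - apply Rlt_le_trans with (1 := Hdist t Ht), Rmin_l. }
    destruct (cderiv_components _ _ _ _ Hc) as [H1 H2]; simpl in H1, H2.
    assert (Hid : derivable_pt_lim (fun t => fst z0 + t) t 1).
    { replace 1 with (0 + 1) by ring.
      apply (derivable_pt_lim_plus (fun _ => fst z0) (fun t => t));
        [apply derivable_pt_lim_const|apply derivable_pt_lim_id]. }
    assert (Hcst : derivable_pt_lim (fun _ : R => snd z0) t 0) by apply derivable_pt_lim_const.
    split.
    - pose proof (derivable_pt_lim_comp_2d _ _ _ _ _ _ _ _ H1 Hid Hcst) as H.
      replace (0 * 1 + - 0 * 0) with 0 in H by ring; exact H.
    - pose proof (derivable_pt_lim_comp_2d _ _ _ _ _ _ _ _ H2 Hid Hcst) as H.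
      replace (0 * 1 + 0 * 0) with 0 in H by ring; exact H. }
  assert (E : b (pt 0) = b (pt (rho / 2))).
  { assert (E1 : Re (b (pt 0)) = Re (b (pt (rho / 2)))).
    { apply (eq_is_derive (V := R_NormedModule) (fun t => Re (b (pt t))) 0 (rho / 2)); [|lra].
      intros t Ht; apply is_derive_Reals, Hder, Ht. }
    assert (E2 : Im (b (pt 0)) = Im (b (pt (rho / 2)))).
    { apply (eq_is_derive (V := R_NormedModule) (fun t => Im (b (pt t))) 0 (rho / 2)); [|lra].
      intros t Ht; apply is_derive_Reals, Hder, Ht. }
    unfold Re, Im in E1, E2.
    rewrite (surjective_pairing (b (pt 0))), E1, E2, <- surjective_pairing; reflexivity. }
  apply Hinj in E; [|apply Hdisc, Hdist; lra|apply Hdisc, Hdist; lra].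
  unfold pt in E; injection E; lra.
Qed.

Lemma ccont_affine (u : C -> C) (c d z : C) :
  ccont u z -> ccont (fun w => c * u w + d * w)%C z.
Proof.
  intros Hu eps He.
  pose proof (Cmod_ge_0 c); pose proof (Cmod_ge_0 d).
  set (e := eps / (Cmod c + Cmod d + 1)).
  assert (Hee : 0 < e) by (apply Rdiv_lt_0_compat; lra).
  destruct (Hu e Hee) as (delta & Hd & Hw).
  exists (Rmin delta e); split; [apply Rmin_pos; assumption|].
  intros w Hlt; pose proof (Rmin_l delta e); pose proof (Rmin_r delta e).
  specialize (Hw w ltac:(lra)).
  replace (c * u w + d * w - (c * u z + d * z))%C
    with (c * (u w - u z) + d * (w - z))%C by ring.
  apply Rle_lt_trans with (1 := Cmod_triangle _ _); rewrite !Cmod_mult.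
  replace eps with ((Cmod c + Cmod d + 1) * e) by (unfold e; field; lra).
  assert (Cmod c * Cmod (u w - u z) <= Cmod c * e) by (apply Rmult_le_compat_l; lra).
  assert (Cmod d * Cmod (w - z) <= Cmod d * e) by (apply Rmult_le_compat_l; lra).
  lra.
Qed.

Lemma ccont_sqr (u : C -> C) (z : C) (eps : R) :
  ccont u z -> 0 < eps -> exists delta, 0 < delta /\
    forall w, Cmod (w - z) < delta -> Cmod (u w) ^ 2 < Cmod (u z) ^ 2 + eps.
Proof.
  intros Hu He.
  set (m := Cmod (u z)); assert (Hm : 0 <= m) by apply Cmod_ge_0.
  set (e := Rmin 1 (eps / (2 * m + 2))).
  assert (Hq : 0 < eps / (2 * m + 2)) by (apply Rdiv_lt_0_compat; lra).
  assert (Hee : 0 < e) by (apply Rmin_pos; lra).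
  assert (H1 : e <= 1) by apply Rmin_l.
  assert (H2 : e * (2 * m + 2) <= eps).
  { apply Rle_trans with (eps / (2 * m + 2) * (2 * m + 2)); [|apply Req_le; field; lra].
    apply Rmult_le_compat_r; [lra|apply Rmin_r]. }
  destruct (Hu e Hee) as (delta & Hd & Hw); exists delta; split; [exact Hd|].
  intros w Hlt; specialize (Hw w Hlt).
  pose proof (Cmod_triangle_rev (u w) (u z)) as T; fold m in T.
  pose proof (Cmod_ge_0 (u w)).
  assert (Cmod (u w) < m + e) by lra.
  nra.
Qed.

Lemma quotient_ccont (a b : C -> C) (z0 la lb : C) :
  a z0 = 0 -> b z0 = 0 -> cderiv a z0 la -> cderiv b z0 lb -> lb <> 0 ->
  forall eps, 0 < eps -> exists delta, 0 < delta /\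
    forall w, w <> z0 -> Cmod (w - z0) < delta -> Cmod (a w / b w - la / lb) < eps.
Proof.
  intros Ea Eb Ha Hb Hl eps He.
  pose proof (Cmod_pos lb Hl) as Hlp; pose proof (Cmod_ge_0 la) as Hla.
  set (L := Cmod lb) in *; set (K := Cmod la + L).
  set (e := Rmin (L / 2) (eps * (L * L) / (4 * K))).
  assert (HK : 0 < K) by (unfold K; lra).
  assert (Hee : 0 < e).
  { apply Rmin_pos; [lra|]; apply Rdiv_lt_0_compat; [|lra].
    apply Rmult_lt_0_compat; [lra|nra]. }
  assert (He1 : e <= L / 2) by apply Rmin_l.
  assert (He2 : e * (4 * K) <= eps * (L * L)).
  { apply Rle_trans with (eps * (L * L) / (4 * K) * (4 * K)); [|apply Req_le; field; lra].
    apply Rmult_le_compat_r; [lra|apply Rmin_r]. }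
  destruct (Ha e Hee) as (d1 & Hd1 & Wa); destruct (Hb e Hee) as (d2 & Hd2 & Wb).
  exists (Rmin d1 d2); split; [apply Rmin_pos; assumption|].
  intros w Hne Hw; pose proof (Rmin_l d1 d2); pose proof (Rmin_r d1 d2).
  specialize (Wa w ltac:(lra)); specialize (Wb w ltac:(lra)).
  rewrite Ea in Wa; rewrite Eb in Wb.
  pose proof (Cmod_pos _ (Cminus_neq0 _ _ Hne)) as Hx; set (x := Cmod (w - z0)) in *.
  assert (Hbw : L / 2 * x <= Cmod (b w)).
  { pose proof (Cmod_triangle_rev (lb * (w - z0)) (lb * (w - z0) - b w)) as T.
    replace (lb * (w - z0) - (lb * (w - z0) - b w))%C with (b w) in T by ring.
    rewrite (Cmod_minus_sym (lb * (w - z0)) (b w)), Cmod_mult in T; fold x L in T.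
    replace (b w - 0 - lb * (w - z0))%C with (b w - lb * (w - z0))%C in Wb by ring.
    nra. }
  assert (Hb0 : b w <> 0).
  { intros E; rewrite E, Cmod_0 in Hbw; nra. }
  replace (a w / b w - la / lb)%C
    with ((lb * (a w - 0 - la * (w - z0)) - la * (b w - 0 - lb * (w - z0))) / (b w * lb))%C
    by (field; split; assumption).
  rewrite Cmod_div by (apply Cmult_neq_0; assumption).
  rewrite Cmod_mult; fold L.
  assert (Hnum : Cmod (lb * (a w - 0 - la * (w - z0)) - la * (b w - 0 - lb * (w - z0))) <= K * (e * x)).
  { unfold Cminus at 1; apply Rle_trans with (1 := Cmod_triangle _ _).
    rewrite Cmod_opp, !Cmod_mult; fold L; unfold K.
    assert (L * Cmod (a w - 0 - la * (w - z0)) <= L * (e * x)) by (apply Rmult_le_compat_l; lra).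
    assert (Cmod la * Cmod (b w - 0 - lb * (w - z0)) <= Cmod la * (e * x))
      by (apply Rmult_le_compat_l; lra).
    lra. }
  assert (0 < Cmod (b w)) by nra.
  apply Rlt_div_l; [nra|].
  apply Rle_lt_trans with (1 := Hnum).
  assert (H3 : eps * (L / 2 * x * L) <= eps * (Cmod (b w) * L)).
  { apply Rmult_le_compat_l; [lra|]; apply Rmult_le_compat_r; lra. }
  assert (H4 : 0 < eps * (L * L) * x) by (repeat apply Rmult_lt_0_compat; lra).
  nra.
Qed.

(** Schwarz's lemma with b in the place of the identity: the quotient a / b is bounded by
    1 / rho where |b| = rho, and by the maximum principle also inside. Since only the mean
    value property at a point is used, the maximum principle is obtained by maximizing
    |a / b|^2 + eps |z|^2: at an interior maximum z1 with u = a / b the function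
    2 conj(u z1) u + 2 eps conj(z1) z would violate the mean value property. *)
Theorem schwarz_univalent (a b : C -> C) (z0 lb : C) (rho : R) :
  0 < rho -> disc z0 ->
  holomorphic_on disc a -> (forall z, disc z -> Cmod (a z) <= 1) -> a z0 = 0 ->
  univalent_on disc b -> b z0 = 0 -> cderiv b z0 lb -> lb <> 0 ->
  (forall w, Cmod w <= rho -> image b disc w) ->
  forall z, disc z -> Cmod (b z) <= rho -> rho * Cmod (a z) <= Cmod (b z).
Proof.
  intros Hrho Hz0 Ha Ha1 Ea Hb Eb Hlb Hlb0 Himg zs Hzs Hbs.
  apply Rnot_lt_le; intros Hlt.
  destruct (proj1 (cdiff_iff _ _) (Ha z0 Hz0)) as [la Hla].
  assert (Hbn : forall z, disc z -> z <> z0 -> b z <> 0).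
  { intros z Hz Hne E; apply Hne, Hb; [assumption|assumption|]; rewrite E, Eb; reflexivity. }
  set (u := fun z => if excluded_middle_informative (z = z0) then (la / lb)%C else (a z / b z)%C).
  assert (Eu : forall z, z <> z0 -> u z = (a z / b z)%C).
  { intros z Hne; unfold u; destruct excluded_middle_informative; [contradiction|reflexivity]. }
  assert (Eu0 : u z0 = (la / lb)%C).
  { unfold u; destruct excluded_middle_informative; [reflexivity|congruence]. }
  assert (Du : forall z, disc z -> z <> z0 -> cdiff u z).
  { intros z Hz Hne.
    apply (cdiff_ext_loc (fun w => a w / b w)%C) with (delta := Cmod (z - z0)).
    - apply Cmod_pos, Cminus_neq0, Hne.
    - intros w Hw; symmetry; apply Eu; intros ->.
      rewrite Cmod_minus_sym in Hw; lra.
    - apply cdiff_div; [apply Hbn| apply Ha|apply Hb]; assumption. }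
  assert (Cu : forall z, disc z -> ccont u z).
  { intros z Hz; destruct (classic (z = z0)) as [->|Hne]; [|apply cdiff_ccont, Du; assumption].
    intros eps He.
    destruct (quotient_ccont a b z0 la lb Ea Eb Hla Hlb Hlb0 eps He) as (d & Hd & Hw).
    exists d; split; [exact Hd|]; intros w Hwd.
    destruct (classic (w = z0)) as [->|Hne].
    - replace (u z0 - u z0)%C with (RtoC 0) by ring; rewrite Cmod_0; exact He.
    - rewrite Eu, Eu0 by assumption; apply Hw; assumption. }
  assert (Hs0 : zs <> z0).
  { intros ->; rewrite Ea, Eb, Cmod_0 in Hlt; lra. }
  assert (Hbs0 : 0 < Cmod (b zs)) by (apply Cmod_pos, Hbn; assumption).
  set (c := / rho).
  assert (Hc : 0 < c) by (apply Rinv_0_lt_compat; exact Hrho).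
  assert (Hus : c < Cmod (u zs)).
  { rewrite Eu, Cmod_div by (try apply Hbn; assumption).
    apply Rlt_div_r; [exact Hbs0|].
    unfold c; apply Rmult_lt_reg_l with rho; [exact Hrho|].
    rewrite <- Rmult_assoc, Rinv_r, Rmult_1_l by lra; exact Hlt. }
  set (eps := (Cmod (u zs) ^ 2 - c ^ 2) / 2).
  assert (He : 0 < eps) by (unfold eps; nra).
  set (psi := fun z => Cmod (u z) ^ 2 + eps * Cmod z ^ 2).
  destruct (max_attained b rho psi Hb ltac:(lra) Himg) as (z1 & Hz1 & Hb1 & Hmax).
  { intros z Hz e Hee.
    destruct (ccont_sqr u z (e / 2) (Cu z Hz) ltac:(lra)) as (d1 & Hd1 & W1).
    destruct (ccont_sqr (fun w => w) z (e / 2 / eps)) as (d2 & Hd2 & W2).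
    { apply cdiff_ccont, cdiff_id. }
    { apply Rdiv_lt_0_compat; lra. }
    exists (Rmin d1 d2); split; [apply Rmin_pos; assumption|].
    intros w Hw; pose proof (Rmin_l d1 d2); pose proof (Rmin_r d1 d2).
    specialize (W1 w ltac:(lra)); specialize (W2 w ltac:(lra)); unfold psi.
    apply (Rmult_lt_compat_l eps) in W2; [|exact He].
    replace (eps * (Cmod z ^ 2 + e / 2 / eps)) with (eps * Cmod z ^ 2 + e / 2) in W2
      by (field; lra).
    lra. }
  specialize (Hmax zs Hzs Hbs) as Hm1; unfold psi in Hm1.
  pose proof (Cmod_ge_0 zs) as P1; pose proof (Cmod_ge_0 z1) as P2.
  assert (Hsq : Cmod z1 ^ 2 < 1) by (unfold disc in Hz1; nra).
  assert (Hz1u : c ^ 2 < Cmod (u z1) ^ 2).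
  { assert (eps * Cmod z1 ^ 2 < eps * 1) by (apply Rmult_lt_compat_l; assumption).
    assert (0 <= eps * Cmod zs ^ 2) by (apply Rmult_le_pos; nra).
    unfold eps in *; lra. }
  destruct Hb1 as [Hb1|Hb1].
  (* on |b| = rho the hypothesis |a| <= 1 already caps |u| by 1 / rho *)
  2:{
    assert (z1 <> z0) by (intros ->; rewrite Eb, Cmod_0 in Hb1; lra).
    rewrite Eu, Cmod_div in Hz1u by (try apply Hbn; assumption).
    rewrite Hb1 in Hz1u.
    specialize (Ha1 z1 Hz1); pose proof (Cmod_ge_0 (a z1)).
    assert (0 <= Cmod (a z1) / rho <= c).
    { split; [apply Rdiv_le_0_compat; lra|]; unfold c, Rdiv.
      rewrite <- (Rmult_1_l (/ rho)) at 2; apply Rmult_le_compat_r; [fold c|]; lra. }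
    nra. }
  destruct (cdiff_ccont b z1 (proj1 Hb z1 Hz1) (rho - Cmod (b z1)) ltac:(lra)) as (d1 & Hd1 & W1).
  (* a radius that keeps z0 out of the punctured disc about z1, also when z1 = z0 *)
  set (d2 := if excluded_middle_informative (z1 = z0) then 1 else Cmod (z0 - z1)).
  assert (Hd2 : 0 < d2).
  { unfold d2; destruct excluded_middle_informative; [lra|].
    apply Cmod_pos, Cminus_neq0; congruence. }
  assert (W2 : forall w, w <> z1 -> Cmod (w - z1) < d2 -> w <> z0).
  { intros w Hne Hw ->; unfold d2 in Hw; destruct excluded_middle_informative; [congruence|lra]. }
  set (R0 := Rmin (1 - Cmod z1) (Rmin d1 d2)).
  assert (HR0 : 0 < R0) by (repeat apply Rmin_pos; unfold disc in Hz1; lra).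
  assert (HR1 : R0 <= 1 - Cmod z1) by apply Rmin_l.
  assert (HR2 : R0 <= d1) by (apply Rle_trans with (1 := Rmin_r _ _), Rmin_l).
  assert (HR3 : R0 <= d2) by (apply Rle_trans with (1 := Rmin_r _ _), Rmin_r).
  (* 2 Re (conj(u1) u) <= |u1|^2 + |u|^2 and maximality of psi at z1 bound the real part
     on the circle by its value at z1 minus eps times the square of the radius *)
  pose proof (submean (fun w => (2 * Cconj (u z1)) * u w + (2 * eps * Cconj z1) * w)%C z1 R0 (R0 / 2)
    (2 * Cmod (u z1) ^ 2 + 2 * eps * Cmod z1 ^ 2 - eps * (R0 / 2) ^ 2)) as S.
  cbv beta in S.
  assert (E0 : Re ((2 * Cconj (u z1)) * u z1 + (2 * eps * Cconj z1) * z1) =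
               2 * Cmod (u z1) ^ 2 + 2 * eps * Cmod z1 ^ 2).
  { rewrite !Cmod2_alt; destruct (u z1), z1; simpl; ring. }
  rewrite E0 in S.
  enough (0 < eps * (R0 / 2) ^ 2 /\ 2 * Cmod (u z1) ^ 2 + 2 * eps * Cmod z1 ^ 2 <=
    2 * Cmod (u z1) ^ 2 + 2 * eps * Cmod z1 ^ 2 - eps * (R0 / 2) ^ 2) by lra.
  split; [apply Rmult_lt_0_compat; [exact He|apply pow_lt; lra]|].
  apply S.
  - lra.
  - intros w Hne Hw.
    apply cdiff_plus; (apply cdiff_mult; [apply cdiff_const|]); [|apply cdiff_id].
    apply Du; [apply (disc_ball z1); [exact Hz1|lra]|apply W2; [exact Hne|lra]].
  - apply ccont_affine, Cu, Hz1.
  - intros th _.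
    pose proof (Cmod_polar z1 (R0 / 2) th ltac:(lra)) as Hp.
    set (w := polar z1 (R0 / 2) th) in *.
    assert (Hdw : disc w) by (apply (disc_ball z1); [exact Hz1|lra]).
    assert (Hbw : Cmod (b w) <= rho).
    { specialize (W1 w ltac:(lra)).
      pose proof (Cmod_triangle_rev (b w) (b z1)); lra. }
    specialize (Hmax w Hdw Hbw); unfold psi in Hmax.
    rewrite <- Hp.
    rewrite !Cmod2_alt in *.
    assert (HI : Re (2 * Cconj (u z1) * u w + 2 * eps * Cconj z1 * w) =
      2 * (Re (u z1) * Re (u w) + Im (u z1) * Im (u w)) +
      2 * eps * (Re z1 * Re w + Im z1 * Im w)).
    { destruct (u z1), (u w), z1, w; simpl; ring. }
    rewrite HI.
    assert (HJ : Re (w - z1) = Re w - Re z1 /\ Im (w - z1) = Im w - Im z1) by (split; reflexivity).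
    destruct HJ as [-> ->].
    pose proof (pow2_ge_0 (Re (u z1) - Re (u w))); pose proof (pow2_ge_0 (Im (u z1) - Im (u w))).
    nra.
Qed.

Lemma halfplane_identity (p q : C) :
  Cmod (p + Cconj q) ^ 2 = Cmod (p - q) ^ 2 + 4 * Re p * Re q.
Proof. rewrite !Cmod2_alt; destruct p, q; simpl; ring. Qed.

Lemma halfplane_le (p q : C) : 0 < Re p -> 0 < Re q -> Cmod (p - q) < Cmod (p + Cconj q).
Proof.
  intros Hp Hq; pose proof (halfplane_identity p q).
  pose proof (Cmod_ge_0 (p - q)); pose proof (Cmod_ge_0 (p + Cconj q)).
  assert (0 < Re p * Re q) by (apply Rmult_lt_0_compat; assumption).
  nra.
Qed.

Lemma Re_pos_neq0 (p : C) : 0 < Re p -> p <> 0.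
Proof. intros H ->; simpl in H; lra. Qed.

(** The image of b contains a disc of radius r about b z0, so f o b^-1 maps this disc to
    the right half-plane, and Schwarz's lemma bounds the half-plane pseudo-distance
    |p - q| / |p + conj q|. When b'(z0) = 0 the quotient in [schwarz_univalent] is not
    controlled at z0; as both sides are continuous in z0, a strict violation would persist
    at a nearby point where b' does not vanish. *)
Theorem subordination (f b : C -> C) (z0 : C) (r : R) :
  holomorphic_on disc f -> (forall z, disc z -> 0 < Re (f z)) ->
  univalent_on disc b -> disc z0 -> 0 < r ->
  (forall w, Cmod (w - b z0) <= r -> image b disc w) ->
  forall z, disc z ->
    r * Cmod (f z - f z0) <= Cmod (b z - b z0) * Cmod (f z + Cconj (f z0)).
Proof.
  intros Hf Hfp Hb Hz0 Hr Himg z Hz.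
  apply Rnot_lt_le; intros Hlt.
  set (A := Cmod (b z - b z0)) in *; set (B := Cmod (f z + Cconj (f z0))) in *.
  set (D := Cmod (f z - f z0)) in *.
  assert (HA : 0 <= A) by apply Cmod_ge_0; assert (HB : 0 <= B) by apply Cmod_ge_0.
  assert (HD : 0 <= D) by apply Cmod_ge_0.
  set (K := A + B + 1 + r + D).
  set (e := Rmin (r / 2) (Rmin 1 ((r * D - A * B) / (2 * K)))).
  assert (HK : 0 < K) by (unfold K; lra).
  assert (Hq : 0 < (r * D - A * B) / (2 * K)) by (apply Rdiv_lt_0_compat; lra).
  assert (He : 0 < e) by (repeat apply Rmin_pos; lra).
  assert (He1 : e <= r / 2) by apply Rmin_l.
  assert (He2 : e <= 1) by (apply Rle_trans with (1 := Rmin_r _ _), Rmin_l).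
  assert (He3 : e * (2 * K) <= r * D - A * B).
  { apply Rle_trans with ((r * D - A * B) / (2 * K) * (2 * K)); [|apply Req_le; field; lra].
    apply Rmult_le_compat_r; [lra|].
    apply Rle_trans with (1 := Rmin_r _ _), Rmin_r. }
  destruct (cdiff_ccont f z0 (Hf z0 Hz0) e He) as (d1 & Hd1 & W1).
  destruct (cdiff_ccont b z0 (proj1 Hb z0 Hz0) e He) as (d2 & Hd2 & W2).
  destruct (univalent_deriv_dense b z0 (Rmin d1 d2) Hb Hz0 (Rmin_pos _ _ Hd1 Hd2))
    as (z1 & l & Hz1 & Hz10 & Hl & Hl0).
  pose proof (Rmin_l d1 d2); pose proof (Rmin_r d1 d2).
  specialize (W1 z1 ltac:(lra)); specialize (W2 z1 ltac:(lra)).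
  set (r1 := r - Cmod (b z1 - b z0)).
  assert (Hr1 : r - e < r1) by (unfold r1; lra).
  assert (BA : Cmod (b z - b z1) <= A + e).
  { replace (b z - b z1)%C with ((b z - b z0) + - (b z1 - b z0))%C by ring.
    apply Rle_trans with (1 := Cmod_triangle _ _); rewrite Cmod_opp; fold A; lra. }
  assert (BB : Cmod (f z + Cconj (f z1)) <= B + e).
  { replace (f z + Cconj (f z1))%C with ((f z + Cconj (f z0)) + Cconj (f z1 - f z0))%C
      by (rewrite Cminus_conj; ring).
    apply Rle_trans with (1 := Cmod_triangle _ _); rewrite Cmod_conj; fold B; lra. }
  assert (BD : D - e <= Cmod (f z - f z1)).
  { pose proof (Cmod_triangle_rev (f z - f z0) (f z1 - f z0)) as T.
    replace (f z - f z0 - (f z1 - f z0))%C with (f z - f z1)%C in T by ring.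
    fold D in T; lra. }
  set (A1 := Cmod (b z - b z1)) in *; set (B1 := Cmod (f z + Cconj (f z1))) in *.
  set (D1 := Cmod (f z - f z1)) in *.
  assert (HA1 : 0 <= A1) by apply Cmod_ge_0.
  assert (HDB : D1 < B1) by (apply halfplane_le; apply Hfp; assumption).
  assert (HD1 : 0 <= D1) by apply Cmod_ge_0.
  assert (Hstrict : A1 * B1 < r1 * D1).
  { apply Rle_lt_trans with ((A + e) * (B + e)); [apply Rmult_le_compat; lra|].
    apply Rlt_le_trans with ((r - e) * D1); [|apply Rmult_le_compat_r; lra].
    apply Rlt_le_trans with ((r - e) * (D - e)); [|apply Rmult_le_compat_l; lra].
    unfold K in He3; nra. }
  assert (Hne : forall w, disc w -> (f w + Cconj (f z1))%C <> 0).
  { intros w Hw; apply Re_pos_neq0; simpl.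
    pose proof (Hfp w Hw); pose proof (Hfp z1 Hz1); unfold Re in *; lra. }
  pose proof (schwarz_univalent (fun w => (f w - f z1) / (f w + Cconj (f z1)))%C
    (fun w => b w - b z1)%C z1 l r1) as S.
  cbv beta in S.
  assert (HS : r1 * Cmod ((f z - f z1) / (f z + Cconj (f z1))) <= A1).
  { apply S.
    - lra.
    - exact Hz1.
    - intros w Hw; apply cdiff_div; [apply Hne, Hw| |].
      + apply cdiff_minus; [apply Hf, Hw|apply cdiff_const].
      + apply cdiff_plus; [apply Hf, Hw|apply cdiff_const].
    - intros w Hw; rewrite Cmod_div by apply Hne, Hw.
      apply Rle_div_l; [apply Cmod_pos, Hne, Hw|].
      rewrite Rmult_1_l; apply Rlt_le, halfplane_le; apply Hfp; assumption.
    - unfold Cdiv, Cminus; rewrite Cplus_opp_r; ring.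
    - split.
      + intros w Hw; apply cdiff_minus; [apply Hb, Hw|apply cdiff_const].
      + intros w w' Hw Hw' E; apply Hb; try assumption.
        replace (b w) with (b w - b z1 + b z1)%C by ring; rewrite E; ring.
    - ring.
    - intros eps Hep; destruct (Hl eps Hep) as (d & Hd & Hw); exists d; split; [exact Hd|].
      intros w Hwd.
      replace (b w - b z1 - (b z1 - b z1) - l * (w - z1))%C
        with (b w - b z1 - l * (w - z1))%C by ring.
      apply Hw, Hwd.
    - exact Hl0.
    - intros w Hw; destruct (Himg (w + b z1)%C) as (x & Hx & E).
      + replace (w + b z1 - b z0)%C with (w + (b z1 - b z0))%C by ring.
        apply Rle_trans with (1 := Cmod_triangle _ _); unfold r1 in Hw; lra.
      + exists x; split; [exact Hx|]; rewrite E; ring.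
    - exact Hz.
    - fold A1; apply Rnot_lt_le; intros Hgt; nra. }
  rewrite Cmod_div in HS by apply Hne, Hz; fold D1 B1 in HS.
  assert (0 < B1) by lra.
  apply Rmult_le_compat_r with (r := B1) in HS; [|lra].
  replace (r1 * (D1 / B1) * B1) with (r1 * D1) in HS by (field; lra).
  lra.
Qed.

(** * The half-plane model and the Schwarz-Pick lemma *)

(** The half-plane model adapted to [tau]: the disc becomes the right half-plane and [tau]
    goes to infinity. *)
Definition cayley (tau z : C) : C := ((tau + z) / (tau - z))%C.

Lemma cayley_denom (tau z : C) : Cmod tau = 1 -> disc z -> (tau - z)%C <> 0.
Proof.
  intros Ht Hz; apply Cminus_neq0; intros ->; unfold disc in Hz; lra.
Qed.

Lemma Cmod_sqr_neq0 (z : C) : z <> 0 -> Re z ^ 2 + Im z ^ 2 <> 0.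
Proof. intros H; rewrite <- Cmod2_alt; apply pow_nonzero, Rgt_not_eq, Cmod_pos, H. Qed.

Lemma Re_cayley (tau z : C) : Cmod tau = 1 -> disc z ->
  Re (cayley tau z) = (1 - Cmod z ^ 2) / Cmod (tau - z) ^ 2.
Proof.
  intros Ht Hz; pose proof (cayley_denom tau z Ht Hz) as Hn.
  apply Cmod_sqr_neq0 in Hn; simpl in Hn.
  replace 1 with (Cmod tau ^ 2) by (rewrite Ht; ring).
  rewrite !Cmod2_alt.
  unfold cayley; destruct tau as [a b], z as [x y]; simpl in *.
  field; intros E; apply Hn; rewrite <- E; ring.
Qed.

Lemma disc_sqr (z : C) : disc z -> Cmod z ^ 2 < 1.
Proof. unfold disc; pose proof (Cmod_ge_0 z); nra. Qed.

Lemma Re_cayley_pos (tau z : C) : Cmod tau = 1 -> disc z -> 0 < Re (cayley tau z).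
Proof.
  intros Ht Hz; rewrite Re_cayley by assumption.
  apply Rdiv_lt_0_compat; [pose proof (disc_sqr z Hz); lra|].
  apply pow_lt, Cmod_pos, cayley_denom; assumption.
Qed.

Lemma Cmod_cayley_plus1 (tau z : C) : Cmod tau = 1 -> disc z ->
  Cmod (1 + cayley tau z) = 2 / Cmod (tau - z).
Proof.
  intros Ht Hz; pose proof (cayley_denom tau z Ht Hz) as Hn.
  replace (1 + cayley tau z)%C with (2 * tau / (tau - z))%C
    by (unfold cayley; field; exact Hn).
  rewrite Cmod_div, Cmod_mult, Ht, Cmod_R, Rabs_pos_eq by (try lra; assumption).
  rewrite Rmult_1_r; reflexivity.
Qed.

Lemma cayley_univalent (tau : C) : Cmod tau = 1 -> univalent_on disc (cayley tau).
Proof.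
  intros Ht; split.
  - intros z Hz; apply cdiff_div; [apply cayley_denom; assumption| |].
    + apply cdiff_plus; [apply cdiff_const|apply cdiff_id].
    + apply cdiff_minus; [apply cdiff_const|apply cdiff_id].
  - intros z w Hz Hw E; unfold cayley in E.
    pose proof (cayley_denom tau z Ht Hz) as Hn; pose proof (cayley_denom tau w Ht Hw) as Hm.
    assert (Ht0 : tau <> 0) by (intros ->; rewrite Cmod_0 in Ht; lra).
    assert (E2 : (2 * tau * (z - w))%C = 0).
    { replace (2 * tau * (z - w))%C
        with (((tau + z) / (tau - z) - (tau + w) / (tau - w)) * ((tau - z) * (tau - w)))%C
        by (field; split; assumption).
      rewrite E; ring. }
    apply NNPP; intros Hzw.
    apply (Cmult_neq_0 (2 * tau) (z - w));
      [apply Cmult_neq_0; [|exact Ht0]|apply Cminus_neq0, Hzw|exact E2].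
    intros E3; injection E3; lra.
Qed.

Lemma cayley_surjective (tau w : C) : Cmod tau = 1 -> 0 < Re w ->
  exists z, disc z /\ cayley tau z = w.
Proof.
  intros Ht Hw.
  assert (Ht0 : tau <> 0) by (intros ->; rewrite Cmod_0 in Ht; lra).
  assert (Hn : (w + 1)%C <> 0) by (apply Re_pos_neq0; simpl; unfold Re in Hw; lra).
  exists (tau * ((w - 1) / (w + 1)))%C; split.
  - unfold disc; rewrite Cmod_mult, Ht, Rmult_1_l, Cmod_div by exact Hn.
    apply Rlt_div_l; [apply Cmod_pos, Hn|]; rewrite Rmult_1_l.
    replace (w + 1)%C with (w + Cconj 1)%C
      by (f_equal; unfold Cconj, RtoC; simpl; f_equal; ring).
    apply halfplane_le; [exact Hw|simpl; lra].
  - unfold cayley.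
    replace (tau + tau * ((w - 1) / (w + 1)))%C with (2 * tau * w / (w + 1))%C by (field; exact Hn).
    replace (tau - tau * ((w - 1) / (w + 1)))%C with (2 * tau / (w + 1))%C by (field; exact Hn).
    field; repeat split; assumption.
Qed.

Lemma conj_sum_neq0 (p q : C) : 0 < Re p -> 0 < Re q -> (p + Cconj q)%C <> 0.
Proof. intros Hp Hq; apply Re_pos_neq0; simpl; unfold Re in *; lra. Qed.

Lemma halfplane_quotient_surjective (w0 w : C) : 0 < Re w0 -> Cmod w < 1 ->
  exists v, 0 < Re v /\ ((v - w0) / (v + Cconj w0))%C = w.
Proof.
  intros H0 Hw.
  assert (Hn : (1 - w)%C <> 0).
  { apply Cminus_neq0; intros <-; rewrite Cmod_1 in Hw; lra. }
  set (v := ((w0 + w * Cconj w0) / (1 - w))%C).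
  assert (H1 : (v + Cconj w0)%C = ((w0 + Cconj w0) / (1 - w))%C) by (unfold v; field; exact Hn).
  assert (H2 : (v - w0)%C = (w * ((w0 + Cconj w0) / (1 - w)))%C) by (unfold v; field; exact Hn).
  assert (Hs : (w0 + Cconj w0)%C <> 0) by (apply conj_sum_neq0; exact H0).
  exists v; split; [|rewrite H1, H2; field; split; assumption].
  pose proof (halfplane_identity v w0) as HI.
  rewrite H1, H2, Cmod_mult in HI.
  set (m := Cmod ((w0 + Cconj w0) / (1 - w))) in HI.
  assert (Hm : 0 < m).
  { unfold m; rewrite Cmod_div by exact Hn.
    apply Rdiv_lt_0_compat; apply Cmod_pos; assumption. }
  pose proof (Cmod_ge_0 w).
  assert (0 < m ^ 2 * (1 - Cmod w ^ 2)) by (apply Rmult_lt_0_compat; nra).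
  assert (0 < Re w0 * Re v) by nra.
  apply Rmult_lt_reg_l with (Re w0); lra.
Qed.

(** The case of [subordination] where b is the isomorphism of the disc onto the unit disc
    that sends z0 to 0, so that every r < 1 is allowed. *)
Theorem schwarz_pick (tau : C) (f : C -> C) (z0 z : C) :
  Cmod tau = 1 -> holomorphic_on disc f -> (forall z, disc z -> 0 < Re (f z)) ->
  disc z0 -> disc z ->
  Cmod (f z - f z0) * Cmod (cayley tau z + Cconj (cayley tau z0)) <=
  Cmod (cayley tau z - cayley tau z0) * Cmod (f z + Cconj (f z0)).
Proof.
  intros Ht Hf Hfp Hz0 Hz.
  set (W0 := cayley tau z0).
  assert (H0 : 0 < Re W0) by (apply Re_cayley_pos; assumption).
  assert (Hn : forall w, disc w -> (cayley tau w + Cconj W0)%C <> 0).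
  { intros w Hw; apply conj_sum_neq0; [apply Re_cayley_pos|]; assumption. }
  set (b := fun w => ((cayley tau w - W0) / (cayley tau w + Cconj W0))%C).
  destruct (cayley_univalent tau Ht) as [Wh Winj].
  assert (Hb : univalent_on disc b).
  { split.
    - intros w Hw; apply cdiff_div; [apply Hn, Hw| |].
      + apply cdiff_minus; [apply Wh, Hw|apply cdiff_const].
      + apply cdiff_plus; [apply Wh, Hw|apply cdiff_const].
    - intros v w Hv Hw E; apply Winj; try assumption.
      pose proof (Hn v Hv) as Nv; pose proof (Hn w Hw) as Nw; unfold b in E.
      set (V := cayley tau v) in *; set (U := cayley tau w) in *.
      assert (E2 : ((W0 + Cconj W0) * (V - U))%C = 0).
      { replace ((W0 + Cconj W0) * (V - U))%C
          with (((V - W0) / (V + Cconj W0) - (U - W0) / (U + Cconj W0)) *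
                ((V + Cconj W0) * (U + Cconj W0)))%C by (field; split; assumption).
        rewrite E; ring. }
      apply NNPP; intros HVU.
      apply (Cmult_neq_0 (W0 + Cconj W0) (V - U)); [apply conj_sum_neq0; exact H0| |exact E2].
      apply Cminus_neq0, HVU. }
  assert (Eb0 : b z0 = 0).
  { unfold b; fold W0; unfold Cdiv, Cminus; rewrite Cplus_opp_r; ring. }
  set (D := Cmod (f z - f z0)); set (B := Cmod (f z + Cconj (f z0))).
  assert (HD : 0 <= D) by apply Cmod_ge_0.
  assert (Hr : forall r, 0 < r < 1 -> r * D <= Cmod (b z) * B).
  { intros r Hr.
    pose proof (subordination f b z0 r Hf Hfp Hb Hz0 ltac:(lra)) as S.
    rewrite Eb0 in S; replace (b z) with (b z - 0)%C by ring; apply S; [|exact Hz].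
    intros w Hw; replace (w - 0)%C with w in Hw by ring.
    destruct (halfplane_quotient_surjective W0 w H0 ltac:(lra)) as (v & Hv & Ev).
    destruct (cayley_surjective tau v Ht Hv) as (x & Hx & Ex).
    exists x; split; [exact Hx|]; unfold b; rewrite Ex; exact Ev. }
  assert (Hlim : D <= Cmod (b z) * B).
  { apply Rnot_lt_le; intros Hlt.
    assert (HDp : 0 < D).
    { apply Rle_lt_trans with (2 := Hlt), Rmult_le_pos; apply Cmod_ge_0. }
    set (r := (1 + Cmod (b z) * B / D) / 2).
    assert (0 <= Cmod (b z) * B / D < 1).
    { split.
      - apply Rdiv_le_0_compat; [apply Rmult_le_pos; apply Cmod_ge_0|exact HDp].
      - apply Rlt_div_l; lra. }
    specialize (Hr r ltac:(unfold r; lra)).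
    assert (Cmod (b z) * B = (2 * r - 1) * D) by (unfold r; field; lra).
    assert (0 < (1 - r) * D) by (apply Rmult_lt_0_compat; unfold r in *; lra).
    lra. }
  unfold b in Hlim; rewrite Cmod_div in Hlim by apply Hn, Hz.
  assert (HP : 0 < Cmod (cayley tau z + Cconj W0)) by apply Cmod_pos, Hn, Hz.
  apply Rmult_le_compat_r with (r := Cmod (cayley tau z + Cconj W0)) in Hlim; [|lra].
  apply Rle_trans with (1 := Hlim), Req_le; field; lra.
Qed.

(** The complement to 1 of the squares of both pseudo-distances, by [halfplane_identity]. *)
Corollary schwarz_pick_re (tau : C) (f : C -> C) (z0 z : C) :
  Cmod tau = 1 -> holomorphic_on disc f -> (forall z, disc z -> 0 < Re (f z)) ->
  disc z0 -> disc z ->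
  Re (cayley tau z) * Re (cayley tau z0) * Cmod (f z + Cconj (f z0)) ^ 2 <=
  Re (f z) * Re (f z0) * Cmod (cayley tau z + Cconj (cayley tau z0)) ^ 2.
Proof.
  intros Ht Hf Hfp Hz0 Hz.
  pose proof (schwarz_pick tau f z0 z Ht Hf Hfp Hz0 Hz) as H.
  apply (fun H0 H1 => pow_incr _ _ 2 (conj H0 H1)) in H; [|apply Rmult_le_pos; apply Cmod_ge_0].
  rewrite !Rpow_mult_distr in H.
  pose proof (halfplane_identity (f z) (f z0)).
  pose proof (halfplane_identity (cayley tau z) (cayley tau z0)).
  nra.
Qed.

(** * Julia's lemma *)

(** Schwarz-Pick between z and z_k, read as k grows: both distances to z_k are then
    governed by 1 - |z_k|^2, and if phi decreased the real part at z, these numbers would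
    from some k on no longer decrease, although they are positive and tend to 0. *)
Theorem julia (tau : C) (phi : C -> C) (zk : nat -> C) (z : C) :
  Cmod tau = 1 -> holomorphic_on disc phi -> (forall z, disc z -> disc (phi z)) ->
  (forall k, disc (zk k)) -> (forall k, zk (S k) = phi (zk k)) ->
  (forall eps, 0 < eps -> exists n, forall k, (n <= k)%nat -> Cmod (zk k - tau) < eps) ->
  disc z -> Re (cayley tau z) <= Re (cayley tau (phi z)).
Proof.
  intros Ht Hphi Hself Hzk Hstep Hlim Hz.
  apply Rnot_lt_le; intros Hlt.
  set (W := cayley tau) in *.
  set (x := Re (W z)) in *; set (x' := Re (W (phi z))) in *.
  assert (Hx' : 0 < x') by (apply Re_cayley_pos; [exact Ht|apply Hself, Hz]).
  (* a margin for which x' (1 + s)^2 <= x (1 - s)^2 *)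
  set (s := (x - x') / (6 * x)).
  assert (Hs : 0 < s) by (apply Rdiv_lt_0_compat; lra).
  assert (Es : 6 * (s * x) = x - x') by (unfold s; field; lra).
  assert (Hs6 : s < 1 / 6) by (apply Rmult_lt_reg_r with x; lra).
  set (c := Cmod (W z - 1) + Cmod (W (phi z) - 1) + 1).
  pose proof (Cmod_ge_0 (W z - 1)); pose proof (Cmod_ge_0 (W (phi z) - 1)).
  assert (Hc : 0 < c) by (unfold c; lra).
  destruct (Hlim (s / c)) as [n Hn]; [apply Rdiv_lt_0_compat; assumption|].
  set (N := fun k => Cmod (1 + W (zk k))).
  assert (HN : forall k, (n <= k)%nat -> c <= s * N k).
  { intros k Hk; specialize (Hn k Hk); unfold N, W.
    rewrite Cmod_cayley_plus1 by (try apply Hzk; exact Ht).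
    rewrite Cmod_minus_sym in Hn.
    assert (Hp : 0 < Cmod (tau - zk k)) by (apply Cmod_pos, cayley_denom; [exact Ht|apply Hzk]).
    apply Rlt_div_r in Hn; [|exact Hc].
    unfold Rdiv; rewrite <- Rmult_assoc.
    apply (Rle_div_r c (s * 2) (Cmod (tau - zk k)) Hp); lra. }
  assert (Hsum : forall p k, Cmod (p + Cconj (W (zk k))) <= N k + Cmod (p - 1) /\
                             N k - Cmod (p - 1) <= Cmod (p + Cconj (W (zk k)))).
  { intros p k.
    assert (EN : N k = Cmod (1 + Cconj (W (zk k)))).
    { unfold N; rewrite <- Cmod_conj, Cplus_conj; f_equal; f_equal.
      unfold Cconj, RtoC; simpl; f_equal; ring. }
    rewrite EN; split.
    - replace (p + Cconj (W (zk k)))%C with ((1 + Cconj (W (zk k))) + (p - 1))%C by ring.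
      apply Cmod_triangle.
    - pose proof (Cmod_triangle_rev (1 + Cconj (W (zk k))) (1 - p)) as T.
      replace (1 + Cconj (W (zk k)) - (1 - p))%C with (p + Cconj (W (zk k)))%C in T by ring.
      rewrite (Cmod_minus_sym 1 p) in T; exact T. }
  set (d := fun k => 1 - Cmod (zk k) ^ 2).
  assert (Hd : forall k, 0 < d k).
  { intros k; unfold d; pose proof (disc_sqr _ (Hzk k)); lra. }
  assert (HNp : forall k, 0 < N k).
  { intros k; unfold N, W; rewrite Cmod_cayley_plus1 by (try apply Hzk; exact Ht).
    apply Rdiv_lt_0_compat; [lra|]; apply Cmod_pos, cayley_denom; [exact Ht|apply Hzk]. }
  assert (ER : forall k, 4 * Re (W (zk k)) = d k * N k ^ 2).
  { intros k; unfold N, W, d.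
    rewrite Cmod_cayley_plus1, Re_cayley by (try apply Hzk; exact Ht).
    field; apply Rgt_not_eq, Cmod_pos, cayley_denom; [exact Ht|apply Hzk]. }
  assert (Hgrow : forall k, (n <= k)%nat -> d k <= d (S k)).
  { intros k Hk.
    pose proof (schwarz_pick_re tau (fun w => W (phi w)) (zk k) z Ht) as SP.
    cbv beta in SP; rewrite <- Hstep in SP; fold W x x' in SP.
    assert (SP' := SP
      (fun w Hw => cdiff_comp W phi w (proj1 (cayley_univalent tau Ht) _ (Hself w Hw)) (Hphi w Hw))
      (fun w Hw => Re_cayley_pos tau _ Ht (Hself w Hw)) (Hzk k) Hz); clear SP.
    pose proof (HN k Hk) as B0; pose proof (HN (S k) ltac:(lia)) as B1.
    destruct (Hsum (W z) k) as [U _]; destruct (Hsum (W (phi z)) (S k)) as [_ V].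
    assert (U' : Cmod (W z + Cconj (W (zk k))) ^ 2 <= ((1 + s) * N k) ^ 2).
    { apply pow_incr; split; [apply Cmod_ge_0|unfold c in B0; lra]. }
    assert (V' : ((1 - s) * N (S k)) ^ 2 <= Cmod (W (phi z) + Cconj (W (zk (S k)))) ^ 2).
    { apply pow_incr; split; [|unfold c in B1; lra].
      apply Rmult_le_pos; [lra|apply Rlt_le, HNp]. }
    assert (R0 : 0 < Re (W (zk k))) by (apply Re_cayley_pos; [exact Ht|apply Hzk]).
    assert (R1 : 0 < Re (W (zk (S k)))) by (apply Re_cayley_pos; [exact Ht|apply Hzk]).
    assert (K1 : x * Re (W (zk k)) * ((1 - s) * N (S k)) ^ 2 <=
                 x' * Re (W (zk (S k))) * ((1 + s) * N k) ^ 2).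
    { apply Rle_trans with (x * Re (W (zk k)) * Cmod (W (phi z) + Cconj (W (zk (S k)))) ^ 2).
      - apply Rmult_le_compat_l; [apply Rmult_le_pos; lra|exact V'].
      - apply Rle_trans with (1 := SP').
        apply Rmult_le_compat_l; [apply Rmult_le_pos; lra|exact U']. }
    assert (K2 : (x * (1 - s) ^ 2 * d k) * (N k ^ 2 * N (S k) ^ 2) <=
                 (x' * (1 + s) ^ 2 * d (S k)) * (N k ^ 2 * N (S k) ^ 2)).
    { apply Rle_trans with (4 * (x * Re (W (zk k)) * ((1 - s) * N (S k)) ^ 2)).
      - apply Req_le; replace (4 * (x * Re (W (zk k)) * ((1 - s) * N (S k)) ^ 2))
          with (x * (4 * Re (W (zk k))) * ((1 - s) * N (S k)) ^ 2) by ring.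
        rewrite ER; ring.
      - apply Rle_trans with (4 * (x' * Re (W (zk (S k))) * ((1 + s) * N k) ^ 2)); [lra|].
        apply Req_le; replace (4 * (x' * Re (W (zk (S k))) * ((1 + s) * N k) ^ 2))
          with (x' * (4 * Re (W (zk (S k)))) * ((1 + s) * N k) ^ 2) by ring.
        rewrite ER; ring. }
    apply Rmult_le_reg_r in K2; [|apply Rmult_lt_0_compat; apply pow_lt, HNp].
    assert (K3 : x' * (1 + s) ^ 2 <= x * (1 - s) ^ 2) by nra.
    assert (K4 : 0 < x * (1 - s) ^ 2) by (apply Rmult_lt_0_compat; [lra|apply pow_lt; lra]).
    apply Rmult_le_reg_l with (1 := K4).
    apply Rle_trans with (1 := K2).
    apply Rmult_le_compat_r; [apply Rlt_le, Hd|exact K3]. }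
  assert (Hmon : forall j, d n <= d (n + j)%nat).
  { induction j as [|j IH]; [rewrite Nat.add_0_r; lra|].
    rewrite Nat.add_succ_r; specialize (Hgrow (n + j)%nat ltac:(lia)); lra. }
  destruct (Hlim (d n / 2)) as [m Hm]; [specialize (Hd n); lra|].
  specialize (Hm (n + m)%nat ltac:(lia)); specialize (Hmon m).
  pose proof (Cmod_triangle_rev tau (tau - zk (n + m)%nat)) as T.
  replace (tau - (tau - zk (n + m)%nat))%C with (zk (n + m)%nat) in T by ring.
  rewrite Cmod_minus_sym in Hm; rewrite Ht in T.
  pose proof (Hzk (n + m)%nat) as Hzz; unfold disc in Hzz; pose proof (Cmod_ge_0 (zk (n + m)%nat)).
  unfold d in Hmon at 2; nra.
Qed.

(** * The square root on the slit plane *)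

(** The principal square root. *)
Definition csqrt (w : C) : C :=
  let r := sqrt ((Cmod w + Re w) / 2) in (r, Im w / (2 * r)).

Definition slit_plane (w : C) : Prop := 0 < Cmod w + Re w.

Lemma Re_csqrt (w : C) : slit_plane w -> 0 < Re (csqrt w).
Proof. intros Hw; unfold slit_plane in Hw; apply sqrt_lt_R0; lra. Qed.

Lemma csqrt_sqr (w : C) : slit_plane w -> (csqrt w * csqrt w)%C = w.
Proof.
  intros Hw; pose proof (Re_csqrt w Hw) as Hp.
  unfold slit_plane in Hw; unfold csqrt in *; simpl in Hp.
  set (r := sqrt ((Cmod w + Re w) / 2)) in *.
  assert (Er : r * r = (Cmod w + Re w) / 2) by (apply sqrt_sqrt; lra).
  pose proof (Cmod2_alt w) as E2.
  destruct w as [x y]; unfold Cmult; simpl in *; f_equal; [|field; lra].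
  set (m := Cmod (x, y)) in *.
  assert (E : y * y = 4 * (r * r) * (r * r - x)) by (rewrite Er; nra).
  replace (y / (2 * r) * (y / (2 * r))) with ((y * y) / (4 * (r * r))) by (field; lra).
  rewrite E; field; lra.
Qed.

(** Differentiability follows from the equation csqrt w ^ 2 = w: the difference
    csqrt v - csqrt w equals (v - w) / (csqrt v + csqrt w), where the denominator has
    modulus at least Re (csqrt w). *)
Lemma cdiff_csqrt (w : C) : slit_plane w -> cdiff csqrt w.
Proof.
  intros Hw; apply cdiff_iff; set (G := csqrt w).
  exists (/ (2 * G))%C; intros eps He.
  pose proof (Re_csqrt w Hw) as Hg; fold G in Hg; set (g := Re G) in *.
  set (e := eps * (2 * g ^ 3)).
  assert (Hg3 : 0 < g ^ 3) by (apply pow_lt; exact Hg).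
  assert (Hee : 0 < e) by (apply Rmult_lt_0_compat; lra).
  unfold slit_plane in Hw.
  exists (Rmin e ((Cmod w + Re w) / 2)); split; [apply Rmin_pos; lra|].
  intros v Hv.
  pose proof (Rmin_l e ((Cmod w + Re w) / 2)); pose proof (Rmin_r e ((Cmod w + Re w) / 2)).
  assert (Hsv : slit_plane v).
  { unfold slit_plane.
    pose proof (Cmod_triangle_rev w (w - v)) as T.
    replace (w - (w - v))%C with v in T by ring; rewrite Cmod_minus_sym in T.
    pose proof (re_le_Cmod (v - w)) as T2.
    assert (Re (v - w) = Re v - Re w) by reflexivity.
    apply Rabs_le_between in T2; lra. }
  set (H' := csqrt v); pose proof (Re_csqrt v Hsv) as Hh; fold H' in Hh.
  assert (HG0 : G <> 0) by (apply Re_pos_neq0; exact Hg).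
  assert (HS0 : (H' + G)%C <> 0).
  { apply Re_pos_neq0; change (0 < Re H' + g); lra. }
  assert (H20 : (2 : C) <> 0) by (intros E3; injection E3; lra).
  assert (Evw : (v - w)%C = ((H' - G) * (H' + G))%C).
  { rewrite <- (csqrt_sqr v Hsv) at 1; rewrite <- (csqrt_sqr w Hw) at 1; fold G H'; ring. }
  fold G; replace (H' - G - / (2 * G) * (v - w))%C
    with (- ((v - w) * (v - w) / (2 * G * ((H' + G) * (H' + G)))))%C
    by (rewrite Evw; field; repeat split; assumption).
  rewrite Cmod_opp, Cmod_div, !Cmod_mult by (repeat apply Cmult_neq_0; assumption).
  rewrite Cmod_R, Rabs_pos_eq by lra.
  assert (B1 : g <= Cmod G) by (apply Rle_trans with (2 := re_le_Cmod G), Rle_abs).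
  assert (B2 : g <= Cmod (H' + G)).
  { apply Rle_trans with (2 := re_le_Cmod (H' + G)).
    apply Rle_trans with (2 := Rle_abs _); change (g <= Re H' + g); lra. }
  set (x := Cmod (v - w)) in *; assert (0 <= x) by apply Cmod_ge_0.
  assert (B3 : 2 * g ^ 3 <= 2 * Cmod G * (Cmod (H' + G) * Cmod (H' + G))).
  { replace (2 * g ^ 3) with (2 * g * (g * g)) by ring.
    apply Rmult_le_compat; [lra|apply Rle_0_sqr|lra|].
    apply Rmult_le_compat; lra. }
  apply Rle_div_l; [lra|].
  apply Rle_trans with (eps * x * (2 * g ^ 3)).
  - replace (eps * x * (2 * g ^ 3)) with (x * e) by (unfold e; ring).
    apply Rmult_le_compat_l; lra.
  - apply Rmult_le_compat_l; [apply Rmult_le_pos; lra|exact B3].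
Qed.

(** * Growth along orbits *)

Lemma sector_of_slope (beta : R) (v : C) :
  0 < beta < PI / 2 -> 0 < Re v -> Rabs (Im v) < Re v * tan beta -> sector beta v.
Proof.
  intros Hb Hx Hy; destruct v as [x y]; simpl in Hx, Hy.
  apply Rabs_def2 in Hy; destruct Hy as [Hy1 Hy2].
  assert (H1 : y / x < tan beta) by (apply Rlt_div_l; lra).
  assert (H2 : - tan beta < y / x) by (apply Rlt_div_r; lra).
  exists (Cmod (x, y)), (atan (y / x)); repeat split.
  - apply Cmod_pos, Re_pos_neq0; exact Hx.
  - assert (Hat : atan (tan beta) = beta) by (apply atan_tan; lra).
    apply Rabs_def1.
    + rewrite <- Hat; apply atan_increasing, H1.
    + rewrite <- Hat, <- atan_opp; apply atan_increasing, H2.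
  - rewrite cos_atan, sin_atan.
    assert (Es : sqrt (1 + (y / x)²) = Cmod (x, y) / x).
    { apply sqrt_lem_1.
      - unfold Rsqr; pose proof (Rle_0_sqr (y / x)); unfold Rsqr in *; lra.
      - apply Rdiv_le_0_compat; [apply Cmod_ge_0|exact Hx].
      - replace (Cmod (x, y) / x * (Cmod (x, y) / x)) with (Cmod (x, y) ^ 2 / (x * x)) by (field; lra).
        rewrite Cmod2_alt; simpl; unfold Rsqr; field; lra. }
    rewrite Es.
    assert (Hm : 0 < Cmod (x, y)) by (apply Cmod_pos, Re_pos_neq0; exact Hx).
    set (m := Cmod (x, y)) in *.
    unfold RtoC, Cmult; simpl; f_equal; field; lra.
Qed.

(** The ball about a point of height t on the axis that touches the sides of the sector has
    radius proportional to t, and the half-line from w0 stays at bounded distance from the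
    axis. *)
Lemma sector_contains_growing_balls (Omega : C -> Prop) (beta : R) (q : C) :
  0 < beta < PI / 2 -> (forall v, sector beta v -> Omega (q + Ci * v)%C) ->
  exists kappa, 0 < kappa /\ forall w0, exists T, 0 < T /\
    forall t w, T <= t -> Cmod (w - (w0 + Ci * RtoC t)) <= kappa * t -> Omega w.
Proof.
  intros Hb HS.
  assert (Hm : 0 < tan beta) by (apply tan_gt_0; lra).
  set (m := tan beta) in *.
  (* k / (1 - k) < m: a ball of radius k t about t stays below the slope m *)
  set (k := m / (2 * (1 + m))).
  assert (Hk : 0 < k) by (apply Rdiv_lt_0_compat; lra).
  assert (Hk1 : k < 1) by (apply Rlt_div_l; lra).
  assert (Ek : 2 * (k + k * m) = m) by (unfold k; field; lra).
  exists (k / 2); split; [lra|]; intros w0.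
  exists (2 * Cmod (w0 - q) / k + 1); split.
  { assert (0 <= 2 * Cmod (w0 - q) / k); [|lra].
    apply Rdiv_le_0_compat; [pose proof (Cmod_ge_0 (w0 - q)); lra|exact Hk]. }
  intros t w Ht Hw.
  assert (Hq : 2 * Cmod (w0 - q) <= k * t).
  { apply Rle_trans with (k * (2 * Cmod (w0 - q) / k)); [apply Req_le; field; lra|].
    apply Rmult_le_compat_l; lra. }
  assert (Htp : 0 < t).
  { assert (0 <= 2 * Cmod (w0 - q) / k); [|lra].
    apply Rdiv_le_0_compat; [pose proof (Cmod_ge_0 (w0 - q)); lra|exact Hk]. }
  set (v := (- Ci * (w - q))%C).
  assert (Hci : (Ci * Ci)%C = (- (1))%C).
  { unfold Ci, RtoC, Cmult, Copp; simpl; f_equal; ring. }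
  replace w with (q + Ci * v)%C.
  2:{ unfold v; replace (q + Ci * (- Ci * (w - q)))%C with (q - (Ci * Ci) * (w - q))%C by ring.
      rewrite Hci; ring. }
  assert (Hv : Cmod (v - RtoC t) <= k * t).
  { assert (E : (v - RtoC t)%C = (- Ci * ((w - (w0 + Ci * RtoC t)) + (w0 - q)))%C).
    { unfold v; replace (- Ci * (w - (w0 + Ci * RtoC t) + (w0 - q)))%C
        with (- Ci * (w - q) + (Ci * Ci) * RtoC t)%C by ring.
      rewrite Hci; ring. }
    rewrite E, Cmod_mult, Cmod_opp, Cmod_Ci, Rmult_1_l.
    apply Rle_trans with (1 := Cmod_triangle _ _); lra. }
  assert (Hkt : 0 < t * (1 - k)) by (apply Rmult_lt_0_compat; lra).
  apply HS, sector_of_slope; [exact Hb| |]; fold m.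
  - pose proof (re_le_Cmod (v - RtoC t)) as H1.
    change (Re (v - RtoC t)) with (Re v - t) in H1; apply Rabs_le_between in H1; lra.
  - pose proof (re_le_Cmod (v - RtoC t)) as H1.
    change (Re (v - RtoC t)) with (Re v - t) in H1; apply Rabs_le_between in H1.
    pose proof (Rmax_Cmod (v - RtoC t)%C) as H2.
    pose proof (Rmax_r (Rabs (fst (v - RtoC t)%C)) (Rabs (snd (v - RtoC t)%C))) as H3.
    replace (snd (v - RtoC t)%C) with (Im v) in H2, H3 by (unfold Im; simpl; ring).
    apply Rle_lt_trans with (k * t); [lra|].
    apply Rlt_le_trans with ((t - k * t) * m).
    { replace ((t - k * t) * m) with (t * (m - k * m)) by ring.
      rewrite Rmult_comm; apply Rmult_lt_compat_l; lra. }
    apply Rmult_le_compat_r; lra.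
Qed.

(** Bernoulli's inequality for n = 5 m. *)
Lemma exponential_beats_quartic (lam : R) : 1 < lam ->
  exists n : nat, 64 * (4 * INR n + 2) ^ 4 < lam ^ n.
Proof.
  intros Hl; set (c := lam - 1).
  assert (Hc5 : 0 < c ^ 5) by (apply pow_lt; unfold c; lra).
  destruct (INR_unbounded (64 * 22 ^ 4 / c ^ 5)) as [m0 Hm].
  set (m := S m0).
  assert (Hm1 : 1 <= INR m) by (unfold m; rewrite S_INR; pose proof (pos_INR m0); lra).
  assert (Hm2 : 64 * 22 ^ 4 / c ^ 5 < INR m) by (unfold m; rewrite S_INR; lra).
  apply Rlt_div_l in Hm2; [|exact Hc5].
  exists (m * 5)%nat; rewrite pow_mult, mult_INR.
  apply Rlt_le_trans with ((INR m * c) ^ 5).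
  - apply Rle_lt_trans with (64 * (22 * INR m) ^ 4).
    + apply Rmult_le_compat_l; [lra|]; apply pow_incr; simpl (INR 5); lra.
    + replace (64 * (22 * INR m) ^ 4) with (64 * 22 ^ 4 * INR m ^ 4) by ring.
      replace ((INR m * c) ^ 5) with (INR m * c ^ 5 * INR m ^ 4) by ring.
      apply Rmult_lt_compat_r; [apply pow_lt; lra|exact Hm2].
  - apply pow_incr; split; [apply Rmult_le_pos; unfold c; lra|].
    pose proof (poly m c ltac:(unfold c; lra)) as P.
    replace (1 + c) with lam in P by (unfold c; ring); lra.
Qed.

(** The geometric heart. Multiplying the time by a fixed factor K = lam^n costs at most n
    steps, so W moves by a multiple of n times its real part. If this real part did not
    double, W would have moved, in the hyperbolic sense, by at most about log n, whereas
    the last hypothesis forces a displacement of order log K, that is of order n. Hence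
    the real part doubles from t to K t, and the displacements over successive factors K
    form a geometric sum dominated by the real part at the last time. *)
Lemma stolz_growth (W : R -> C) (lam T : R) :
  1 < lam -> 0 < T ->
  (forall t, T <= t -> 0 < Re (W t)) ->
  (forall s t, T <= s -> s <= t -> Re (W s) <= Re (W t)) ->
  (forall s t, T <= s -> s <= t <= lam * s -> Cmod (W t - W s) <= 2 * Re (W s)) ->
  (forall t K, T <= t -> 16 <= K ->
     (Re (W t) * Re (W (K * t))) ^ 2 * K <= 64 * Cmod (W (K * t)%R + Cconj (W t)) ^ 4) ->
  exists A, 0 <= A /\ forall t, T <= t -> Cmod (W t) <= A * Re (W t).
Proof.
  intros Hl HT Hpos Hmon Hstep Hfar.
  assert (Hchain : forall n s t, T <= s -> s <= t <= lam ^ n * s ->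
     Cmod (W t - W s) <= 2 * INR n * Re (W t)).
  { induction n as [|n IH]; intros s t Hs Ht.
    - simpl in Ht; assert (t = s) by lra; subst t.
      replace (W s - W s)%C with (RtoC 0) by ring; rewrite Cmod_0; simpl; lra.
    - pose proof (Hpos t ltac:(lra)); rewrite S_INR.
      assert (0 <= INR n * Re (W t)) by (apply Rmult_le_pos; [apply pos_INR|lra]).
      destruct (Rle_dec t (lam * s)) as [Hle|Hgt].
      + specialize (Hstep s t Hs ltac:(lra)); specialize (Hmon s t Hs ltac:(lra)); lra.
      + apply Rnot_le_lt in Hgt.
        assert (E : lam * (t / lam) = t) by (field; lra).
        assert (Hs2 : s <= t / lam) by (apply (Rle_div_r s t lam); lra).
        assert (Ht2 : t / lam <= lam ^ n * s).
        { apply (Rle_div_l t (lam ^ n * s) lam); [lra|]; simpl in Ht; lra. }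
        assert (Htt : t / lam <= t) by nra.
        specialize (IH s (t / lam) Hs ltac:(lra)).
        specialize (Hstep (t / lam) t ltac:(lra) ltac:(lra)).
        pose proof (Hmon (t / lam) t ltac:(lra) Htt) as M.
        assert (INR n * Re (W (t / lam)) <= INR n * Re (W t))
          by (apply Rmult_le_compat_l; [apply pos_INR|lra]).
        replace (W t - W s)%C with ((W t - W (t / lam)%R) + (W (t / lam)%R - W s))%C by ring.
        apply Rle_trans with (1 := Cmod_triangle _ _); lra. }
  destruct (exponential_beats_quartic lam Hl) as [n Hn].
  set (K := lam ^ n) in *; set (N := INR n) in *.
  assert (HN : 0 <= N) by apply pos_INR.
  assert (HK : 16 <= K).
  { assert (2 ^ 4 <= (4 * N + 2) ^ 4) by (apply pow_incr; lra); lra. }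
  assert (Hdouble : forall t, T <= t -> 2 * Re (W t) <= Re (W (K * t))).
  { intros t Ht; apply Rnot_lt_le; intros Hlt.
    assert (HKt : t <= K * t) by nra.
    pose proof (Hpos t Ht) as P; pose proof (Hmon t (K * t) Ht HKt) as M.
    pose proof (Hchain n t (K * t) Ht ltac:(unfold K in *; lra)) as C1; fold N in C1.
    specialize (Hfar t K Ht HK).
    set (x := Re (W t)) in *; set (y := Re (W (K * t))) in *.
    set (P4 := Cmod (W (K * t)%R + Cconj (W t))) in *.
    assert (B : P4 <= (4 * N + 2) * x).
    { unfold P4; replace (W (K * t)%R + Cconj (W t))%C
        with ((W (K * t)%R - W t) + RtoC (2 * x))%C.
      - apply Rle_trans with (1 := Cmod_triangle _ _).
        rewrite Cmod_R, Rabs_pos_eq by lra.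
        assert (N * y <= N * (2 * x)) by (apply Rmult_le_compat_l; lra); lra.
      - unfold x; destruct (W t), (W (K * t)%R); unfold RtoC, Cplus, Cminus, Copp, Cconj; simpl.
        f_equal; ring. }
    assert (B4 : P4 ^ 4 <= ((4 * N + 2) * x) ^ 4).
    { apply pow_incr; split; [apply Cmod_ge_0|exact B]. }
    assert (Hx4 : 0 < x ^ 4) by (apply pow_lt; exact P).
    assert (L : x ^ 4 * K <= (x * y) ^ 2 * K).
    { apply Rmult_le_compat_r; [lra|]; replace (x ^ 4) with ((x * x) ^ 2) by ring.
      apply pow_incr; split; [nra|apply Rmult_le_compat_l; lra]. }
    assert (F : x ^ 4 * K <= x ^ 4 * (64 * (4 * N + 2) ^ 4)).
    { rewrite Rpow_mult_distr in B4; lra. }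
    apply Rmult_le_reg_l in F; [lra|exact Hx4]. }
  set (A := Cmod (W T) / Re (W T) + 4 * N).
  assert (HT0 := Hpos T ltac:(lra)).
  assert (HAT : 0 <= Cmod (W T) / Re (W T)) by (apply Rdiv_le_0_compat; [apply Cmod_ge_0|lra]).
  assert (EAT : Cmod (W T) = Cmod (W T) / Re (W T) * Re (W T)) by (field; lra).
  exists A; split; [unfold A; lra|].
  assert (Hind : forall k t, T <= t <= K ^ k * T -> Cmod (W t) <= A * Re (W t)).
  { induction k as [|k IH]; intros t Ht.
    - simpl in Ht; assert (t = T) by lra; subst t.
      assert (0 <= 4 * N * Re (W T)) by (apply Rmult_le_pos; lra).
      unfold A; lra.
    - pose proof (Hpos t ltac:(lra)) as Pt.
      destruct (Rle_dec t (K * T)) as [Hle|Hgt].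
      + pose proof (Hchain n T t ltac:(lra) ltac:(unfold K in *; lra)) as C1; fold N in C1.
        pose proof (Hmon T t ltac:(lra) ltac:(lra)) as M.
        assert (Cmod (W T) <= Cmod (W T) / Re (W T) * Re (W t)).
        { rewrite EAT at 1; apply Rmult_le_compat_l; lra. }
        pose proof (Cmod_triangle_rev (W t) (W T)).
        assert (0 <= N * Re (W t)) by (apply Rmult_le_pos; lra).
        unfold A; lra.
      + apply Rnot_le_lt in Hgt.
        assert (E : K * (t / K) = t) by (field; lra).
        assert (Hs2 : T <= t / K) by (apply (Rle_div_r T t K); lra).
        assert (Ht2 : t / K <= K ^ k * T).
        { apply (Rle_div_l t (K ^ k * T) K); [lra|]; simpl in Ht; lra. }
        assert (Htt : t / K <= t) by nra.
        specialize (IH (t / K) ltac:(lra)).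
        pose proof (Hdouble (t / K) Hs2) as D; rewrite E in D.
        pose proof (Hchain n (t / K) t Hs2) as C1; fold K N in C1.
        specialize (C1 ltac:(lra)).
        pose proof (Cmod_triangle_rev (W t) (W (t / K)%R)).
        assert (A * (2 * Re (W (t / K))) <= A * Re (W t)).
        { apply Rmult_le_compat_l; [unfold A|]; lra. }
        assert (0 <= Cmod (W T) / Re (W T) * Re (W t)) by (apply Rmult_le_pos; lra).
        unfold A in *; lra. }
  intros t Ht.
  destruct (Pow_x_infinity K) with (b := t / T) as [k Hk].
  { rewrite Rabs_pos_eq; lra. }
  specialize (Hk k (le_n k)).
  rewrite Rabs_pos_eq in Hk by (apply pow_le; lra).
  apply (Hind k); split; [exact Ht|].
  apply Rge_le in Hk; apply (Rle_div_l t (K ^ k) T) in Hk; lra.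
Qed.

(** * Semigroups and their Koenigs functions *)

Lemma locally_Cmod (z : C) (eps : R) : 0 < eps -> locally z (fun w => Cmod (w - z) < eps).
Proof.
  intros He.
  assert (Hs : 0 < sqrt 2) by (apply sqrt_lt_R0; lra).
  assert (Hd : 0 < eps / sqrt 2) by (apply Rdiv_lt_0_compat; assumption).
  exists (mkposreal _ Hd); intros w Hw.
  apply C_NormedModule_mixin_compat2 in Hw; simpl in Hw.
  apply Rlt_le_trans with (1 := Hw), Req_le; field; lra.
Qed.

(** The point in [non_elliptic] and the point tau are limits of the same orbit. *)
Lemma denjoy_wolff_boundary (phi : R -> C -> C) (tau : C) :
  non_elliptic phi -> denjoy_wolff_point phi tau -> Cmod tau = 1.
Proof.
  intros (tau' & [_ H'] & Ht') [_ H].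
  assert (H0 : disc 0) by (unfold disc; rewrite Cmod_0; lra).
  replace tau with tau'; [exact Ht'|].
  apply (filterlim_locally_unique (F := Rbar_locally p_infty) (V := C_NormedModule)
           (fun t => phi t 0) tau' tau (H' 0 H0) (H 0 H0)).
Qed.

Lemma dw_orbit_limit (phi : R -> C -> C) (tau z : C) (eps : R) :
  denjoy_wolff_point phi tau -> disc z -> 0 < eps ->
  exists M, forall t, M < t -> Cmod (phi t z - tau) < eps.
Proof.
  intros [_ H] Hz He.
  exact (H z Hz _ (locally_Cmod tau eps He)).
Qed.

(** Julia's lemma for the map phi (t - s), along the sequence of its iterates. *)
Lemma orbit_julia (phi : R -> C -> C) (tau z : C) (s t : R) :
  semigroup phi -> Cmod tau = 1 -> denjoy_wolff_point phi tau -> disc z ->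
  0 <= s <= t -> Re (cayley tau (phi s z)) <= Re (cayley tau (phi t z)).
Proof.
  intros (Hself & H0 & Hadd & _) Ht Htau Hz Hst.
  destruct (proj2 Hst) as [Hlt|E]; [|rewrite E; apply Rle_refl].
  set (d := t - s).
  assert (Hkd : forall k, 0 <= INR k * d) by (intros k; apply Rmult_le_pos;
    [apply pos_INR|unfold d; lra]).
  replace t with (d + s) by (unfold d; ring).
  rewrite Hadd by (unfold d; try assumption; lra).
  apply (julia tau (phi d) (fun k => phi (INR k * d) z)).
  - exact Ht.
  - apply Hself; unfold d; lra.
  - apply Hself; unfold d; lra.
  - intros k; apply Hself; [apply Hkd|exact Hz].
  - intros k; rewrite <- Hadd by (try apply Hkd; try exact Hz; unfold d; lra).
    f_equal; rewrite S_INR; ring.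
  - intros eps He; destruct (dw_orbit_limit phi tau z eps Htau Hz He) as [M HM].
    destruct (INR_unbounded (M / d)) as [n Hn].
    exists n; intros k Hk; apply HM.
    apply le_INR in Hk.
    apply (Rlt_div_l M (INR k) d); unfold d in *; lra.
  - apply Hself; [lra|exact Hz].
Qed.

(** Liouville's theorem for the inverse of h: in [subordination] the radius r would be
    arbitrary. *)
Lemma univalent_image_proper (h : C -> C) :
  univalent_on disc h -> exists p, ~ image h disc p.
Proof.
  intros Hh; apply NNPP; intros Hno.
  assert (Hall : forall w, image h disc w).
  { intros w; apply NNPP; intros Hw; apply Hno; exists w; exact Hw. }
  assert (H0 : disc 0) by (unfold disc; rewrite Cmod_0; lra).
  assert (H1 : disc (RtoC (1 / 2))) by (unfold disc; rewrite Cmod_R, Rabs_pos_eq; lra).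
  destruct (cayley_univalent 1 Cmod_1) as [Wh Winj].
  set (f := cayley 1) in *.
  set (D := Cmod (f (RtoC (1 / 2)) - f 0)).
  set (B := Cmod (h (RtoC (1 / 2)) - h 0) * Cmod (f (RtoC (1 / 2)) + Cconj (f 0))).
  assert (HD : 0 < D).
  { apply Cmod_pos, Cminus_neq0; intros E; apply Winj in E; try assumption.
    injection E; lra. }
  assert (HB : 0 <= B) by (apply Rmult_le_pos; apply Cmod_ge_0).
  pose proof (subordination f h 0 (B / D + 1) Wh
    (fun z Hz => Re_cayley_pos 1 z Cmod_1 Hz) Hh H0) as S.
  assert (0 <= B / D) by (apply Rdiv_le_0_compat; assumption).
  specialize (S ltac:(lra) (fun w _ => Hall w) _ H1); fold D B in S.
  replace ((B / D + 1) * D) with (B + D) in S by (field; lra); lra.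
Qed.

(** With p the whole ray below p is omitted, since the image is stable under upward
    translations. *)
Lemma koenigs_slit (phi : R -> C -> C) (h : C -> C) (p z : C) :
  semigroup phi -> koenigs_function phi h -> ~ image h disc p -> disc z ->
  slit_plane (- Ci * (h z - p))%C.
Proof.
  intros (Hself & _) (_ & Hint & _) Hp Hz.
  set (u := (- Ci * (h z - p))%C).
  assert (Hci : (Ci * Ci)%C = (- (1))%C).
  { unfold Ci, RtoC, Cmult, Copp; simpl; f_equal; ring. }
  apply Rnot_le_lt; intros Hle; apply Hp.
  pose proof (Cmod_ge_0 u) as H0.
  assert (Hre : Re u <= 0) by lra.
  assert (Him : Im u = 0).
  { pose proof (Cmod2_alt u).
    assert (Cmod u ^ 2 <= Re u ^ 2) by nra.
    assert (Im u ^ 2 <= 0) by lra; nra. }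
  exists (phi (- Re u) z); split; [apply Hself; [lra|exact Hz]|].
  rewrite Hint by (try exact Hz; lra).
  assert (Eu : u = RtoC (Re u)).
  { rewrite (surjective_pairing u) at 1; unfold Im in Him; rewrite Him; reflexivity. }
  rewrite RtoC_opp, <- Eu; unfold u.
  replace (h z + Ci * - (- Ci * (h z - p)))%C with (h z + (Ci * Ci) * (h z - p))%C by ring.
  rewrite Hci; ring.
Qed.

(** The square root of (h - p) / i maps the disc to the right half-plane, where moduli
    of order sqrt t and sqrt (K t) are at distance of order log K. Schwarz-Pick carries this
    lower bound back to the disc. *)
Lemma koenigs_distance_growth (phi : R -> C -> C) (h : C -> C) (tau p z : C) (t K : R) :
  semigroup phi -> koenigs_function phi h -> Cmod tau = 1 -> ~ image h disc p -> disc z ->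
  0 < t -> Cmod (h z - p) <= t -> 16 <= K ->
  (Re (cayley tau (phi t z)) * Re (cayley tau (phi (K * t) z))) ^ 2 * K <=
  64 * Cmod (cayley tau (phi (K * t)%R z) + Cconj (cayley tau (phi t z))) ^ 4.
Proof.
  intros Hphi Hh Ht Hp Hz Htp Hpt HK.
  set (G := fun x => csqrt (- Ci * (h x - p))%C).
  assert (HKt : 0 < K * t) by (apply Rmult_lt_0_compat; lra).
  set (t2 := (K * t)%R) in *; assert (Et2 : t2 = K * t) by reflexivity.
  assert (Hslit := fun x Hx => koenigs_slit phi h p x Hphi Hh Hp Hx).
  assert (HGp : forall x, disc x -> 0 < Re (G x)) by (intros x Hx; apply Re_csqrt, Hslit, Hx).
  assert (HGh : holomorphic_on disc G).
  { intros x Hx; apply (cdiff_comp csqrt); [apply cdiff_csqrt, Hslit, Hx|].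
    apply cdiff_mult; [apply cdiff_const|].
    apply cdiff_minus; [apply (proj1 (proj1 Hh)), Hx|apply cdiff_const]. }
  assert (HGm : forall x, disc x -> Cmod (G x) * Cmod (G x) = Cmod (h x - p)).
  { intros x Hx; rewrite <- Cmod_mult; unfold G; rewrite csqrt_sqr by apply Hslit, Hx.
    rewrite Cmod_mult, Cmod_opp, Cmod_Ci; ring. }
  destruct Hphi as (Hself & _); destruct Hh as (_ & Hint & _).
  assert (D1 : disc (phi t z)) by (apply Hself; [lra|exact Hz]).
  assert (D2 : disc (phi t2 z)) by (apply Hself; [lra|exact Hz]).
  pose proof (schwarz_pick_re tau G _ _ Ht HGh HGp D1 D2) as SP.
  pose proof (HGm _ D1) as M1; pose proof (HGm _ D2) as M2.
  rewrite Hint in M1, M2 by (try exact Hz; lra).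
  assert (N1 : Cmod (h z + Ci * RtoC t - p) <= 2 * t).
  { replace (h z + Ci * RtoC t - p)%C with ((h z - p) + Ci * RtoC t)%C by ring.
    apply Rle_trans with (1 := Cmod_triangle _ _).
    rewrite Cmod_mult, Cmod_Ci, Cmod_R, Rabs_pos_eq; lra. }
  assert (N2 : t2 / 2 <= Cmod (h z + Ci * RtoC t2 - p)).
  { pose proof (Cmod_triangle_rev (Ci * RtoC t2) (p - h z)) as T.
    replace (Ci * RtoC t2 - (p - h z))%C with (h z + Ci * RtoC t2 - p)%C in T by ring.
    rewrite Cmod_mult, Cmod_Ci, Cmod_R, Rabs_pos_eq, (Cmod_minus_sym p) in T by lra.
    rewrite Et2 in *; nra. }
  pose proof (Re_cayley_pos tau _ Ht D1) as X1; pose proof (Re_cayley_pos tau _ Ht D2) as X2.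
  set (x1 := Re (cayley tau (phi t z))) in *; set (x2 := Re (cayley tau (phi t2 z))) in *.
  set (P := Cmod (cayley tau (phi t2%R z) + Cconj (cayley tau (phi t z)))) in *.
  pose proof (Cmod_triangle_rev (G (phi t2 z)) (- Cconj (G (phi t z)))) as T.
  replace (G (phi t2 z) - - Cconj (G (phi t z)))%C
    with (G (phi t2 z) + Cconj (G (phi t z)))%C in T by ring.
  rewrite Cmod_opp, Cmod_conj in T.
  pose proof (re_le_Cmod (G (phi t z))) as R1; pose proof (re_le_Cmod (G (phi t2 z))) as R2.
  pose proof (HGp _ D1) as Q1; pose proof (HGp _ D2) as Q2.
  rewrite Rabs_pos_eq in R1, R2 by lra.
  set (u := Cmod (G (phi t z))) in *; set (v := Cmod (G (phi t2 z))) in *.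
  assert (HKt16 : 16 * t <= t2) by (rewrite Et2; apply Rmult_le_compat_r; lra).
  assert (Huv : 2 * u <= v) by nra.
  assert (HP : 0 <= P) by apply Cmod_ge_0.
  assert (L1 : x2 * x1 * (v / 2) ^ 2 <= v * u * P ^ 2).
  { apply Rle_trans with (x2 * x1 * Cmod (G (phi t2 z) + Cconj (G (phi t z))) ^ 2).
    - apply Rmult_le_compat_l; [apply Rmult_le_pos; lra|].
      apply pow_incr; split; lra.
    - apply Rle_trans with (1 := SP).
      apply Rmult_le_compat_r; [apply pow2_ge_0|].
      apply Rmult_le_compat; lra. }
  assert (L2 : x1 * x2 * v <= 4 * u * P ^ 2).
  { apply Rmult_le_reg_l with v; [lra|].
    replace (v * (x1 * x2 * v)) with (4 * (x2 * x1 * (v / 2) ^ 2)) by field.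
    replace (v * (4 * u * P ^ 2)) with (4 * (v * u * P ^ 2)) by ring; lra. }
  apply (fun H0 H1 => pow_incr _ _ 2 (conj H0 H1)) in L2;
    [|repeat apply Rmult_le_pos; lra].
  replace ((x1 * x2 * v) ^ 2) with ((x1 * x2) ^ 2 * (v * v)) in L2 by ring.
  replace ((4 * u * P ^ 2) ^ 2) with (16 * P ^ 4 * (u * u)) in L2 by ring.
  assert (L3 : (x1 * x2) ^ 2 * (t2 / 2) <= (x1 * x2) ^ 2 * (v * v)).
  { apply Rmult_le_compat_l; [apply pow2_ge_0|lra]. }
  assert (L4 : 16 * P ^ 4 * (u * u) <= 16 * P ^ 4 * (2 * t)).
  { apply Rmult_le_compat_l; [|lra].
    apply Rmult_le_pos; [lra|apply pow_le; exact HP]. }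
  apply Rmult_le_reg_r with (t / 2); [lra|].
  rewrite Et2 in L3; lra.
Qed.

(** In the coordinate W = cayley tau z one has |tau - z| = 2 / |1 + W| and
    1 - |z|^2 = 4 Re W / |1 + W|^2, so a Stolz angle is a bound of |1 + W| by Re W. *)
Lemma stolz_of_cayley_bound (tau z : C) (A x0 : R) :
  Cmod tau = 1 -> disc z -> 0 < x0 -> x0 <= Re (cayley tau z) ->
  Cmod (cayley tau z) <= A * Re (cayley tau z) ->
  Cmod (tau - z) < (A + / x0 + 1) * (1 - Cmod z).
Proof.
  intros Ht Hz Hx0 Hx HA.
  pose proof (Cmod_pos _ (cayley_denom tau z Ht Hz)) as Hd.
  pose proof (Cmod_triangle 1 (cayley tau z)) as T.
  rewrite Cmod_cayley_plus1, Cmod_1 in T by assumption.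
  pose proof (Re_cayley tau z Ht Hz) as ER.
  set (x := Re (cayley tau z)) in *; set (d := Cmod (tau - z)) in *; set (m := Cmod z) in *.
  assert (Hm : m < 1) by exact Hz; assert (Hm0 : 0 <= m) by apply Cmod_ge_0.
  assert (H1 : 1 <= / x0 * x).
  { rewrite <- (Rinv_l x0) by lra.
    apply Rmult_le_compat_l; [apply Rlt_le, Rinv_0_lt_compat; lra|lra]. }
  assert (H2 : 2 / d <= (A + / x0) * x) by lra.
  assert (Ex : x * d ^ 2 = 1 - m ^ 2) by (rewrite ER; field; lra).
  assert (H3 : 2 * d <= (A + / x0) * (1 - m ^ 2)).
  { rewrite <- Ex; replace (2 * d) with (2 / d * d ^ 2) by (field; lra).
    rewrite <- Rmult_assoc; apply Rmult_le_compat_r; [apply pow2_ge_0|exact H2]. }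
  assert (H4 : 0 < A + / x0).
  { apply Rmult_lt_reg_r with x; [lra|]; rewrite Rmult_0_l.
    apply Rlt_le_trans with (2 := H2); apply Rdiv_lt_0_compat; lra. }
  assert (H5 : (A + / x0) * (1 - m ^ 2) <= (A + / x0) * (2 * (1 - m))).
  { apply Rmult_le_compat_l; [lra|nra]. }
  lra.
Qed.

Theorem proposition4p13 (phi : R -> C -> C) (h : C -> C) (tau : C)
  (Hphi : semigroup phi)
  (Hne : non_elliptic phi)
  (Htau : denjoy_wolff_point phi tau)
  (Hh : koenigs_function phi h)
  (Hsector : exists (beta : R) (q : C),
     0 < beta < PI / 2 /\ image h disc q /\
     forall v : C, sector beta v -> image h disc (q + Ci * v)%C) :
  forall z : C, disc z -> non_tangential (fun t => phi t z) tau.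
Proof.
  intros z Hz.
  pose proof (denjoy_wolff_boundary phi tau Hne Htau) as Ht.
  split; [apply Htau, Hz|].
  destruct Hsector as (beta & q & Hbeta & _ & Hsec).
  destruct (sector_contains_growing_balls (image h disc) beta q Hbeta Hsec)
    as (kap & Hkap & Hballs).
  destruct (Hballs (h z)) as (T1 & HT1 & Hball).
  destruct (univalent_image_proper h (proj1 Hh)) as [p Hp].
  set (T := Rmax T1 (Cmod (h z - p))).
  assert (HTa : T1 <= T) by apply Rmax_l; assert (HTb : Cmod (h z - p) <= T) by apply Rmax_r.
  assert (Hdisc : forall t, 0 <= t -> disc (phi t z)) by (intros t H; apply Hphi; assumption).
  assert (Hpos : forall t, 0 <= t -> 0 < Re (cayley tau (phi t z)))
    by (intros t H; apply Re_cayley_pos; [exact Ht|apply Hdisc, H]).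
  destruct (stolz_growth (fun t => cayley tau (phi t z)) (1 + kap / 2) T) as (A & HA & Hbound).
  - lra.
  - lra.
  - intros t HtT; apply Hpos; lra.
  - intros s t Hs Hst; apply orbit_julia; try assumption; lra.
  - intros s t Hs Hst.
    destruct (cayley_univalent tau Ht) as [Wh _].
    assert (Ds : disc (phi s z)) by (apply Hdisc; lra).
    assert (Dt : disc (phi t z)) by (apply Hdisc; lra).
    assert (Hks : 0 < kap * s) by (apply Rmult_lt_0_compat; lra).
    pose proof (subordination (cayley tau) h (phi s z) (kap * s) Wh
      (fun x Hx => Re_cayley_pos tau x Ht Hx) (proj1 Hh) Ds Hks) as S.
    destruct Hh as (_ & Hint & _).
    rewrite (Hint s z) in S by (try exact Hz; lra).
    specialize (S (fun w Hw => Hball s w ltac:(lra) Hw) _ Dt).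
    rewrite (Hint t z) in S by (try exact Hz; lra).
    replace (h z + Ci * RtoC t - (h z + Ci * RtoC s))%C with (Ci * RtoC (t - s))%C in S
      by (rewrite RtoC_minus; ring).
    rewrite Cmod_mult, Cmod_Ci, Cmod_R, Rabs_pos_eq, Rmult_1_l in S by lra.
    pose proof (Hpos s ltac:(lra)) as P.
    set (W1 := cayley tau (phi s z)) in *; set (W2 := cayley tau (phi t z)) in *.
    assert (T2 : Cmod (W2 + Cconj W1) <= Cmod (W2 - W1) + 2 * Re W1).
    { replace (W2 + Cconj W1)%C with ((W2 - W1) + RtoC (2 * Re W1))%C.
      - apply Rle_trans with (1 := Cmod_triangle _ _).
        rewrite Cmod_R, (Rabs_pos_eq (2 * Re W1)) by lra; lra.
      - destruct W1, W2; unfold RtoC, Cplus, Cminus, Copp, Cconj; simpl; f_equal; ring. }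
    pose proof (Cmod_ge_0 (W2 + Cconj W1)).
    assert (S2 : kap * s * Cmod (W2 - W1) <= kap * s * (Cmod (W2 + Cconj W1) / 2)).
    { apply Rle_trans with (1 := S).
      replace (kap * s * (Cmod (W2 + Cconj W1) / 2))
        with (kap * s / 2 * Cmod (W2 + Cconj W1)) by field.
      apply Rmult_le_compat_r; lra. }
    apply Rmult_le_reg_l in S2; lra.
  - intros t K HtT HK; apply (koenigs_distance_growth phi h tau p); try assumption; lra.
  - assert (HTp := Hpos T ltac:(lra)).
    exists (A + / Re (cayley tau (phi T z)) + 1); split.
    + pose proof (Rinv_0_lt_compat _ HTp); lra.
    + exists T; intros t HtT.
      apply stolz_of_cayley_bound; [exact Ht|apply Hdisc; lra|exact HTp| |apply Hbound; lra].
      apply orbit_julia; try assumption; lra.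
Qed.
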